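(* Let $Q=Q(z,D_z)$ be a differential operator of order $m\ge 1$ with smooth coefficients in $Z$, an open subset of $\mathbb R^N$. Assume that there exist a smooth real-valued weight function $\varphi(z)$ on $Z$, $C>0$, $\tau_1>0$, a multi-index $\alpha$ with $0\le|\alpha|\le m$, and $\delta\ge 0$ such that $$\tau^{m-1-|\alpha|+\delta}\,\|e^{\tau\varphi}D_z^\alpha u\|_{L^2}\le C\,\|e^{\tau\varphi}Qu\|_{L^2},$$ for $\tau\ge\tau_1$ and for $u\in C^\infty(\mathbb R^N)$ with $\operatorname{supp}(u)\subset Z$. Let $q(z,\zeta)$ be the principal symbol of $Q$. If there exist $z_0\in Z$, $\zeta_0\in\mathbb R^N$ and $\tau_0>0$ such that, with $\theta_0=\zeta_0+i\tau_0\,d\varphi(z_0)$, one has $\theta_0^\alpha\neq 0$ and $$q(z_0,\theta_0)=0,\qquad d_{z,\zeta}\,q(z_0,\theta_0)=0,$$ then $\delta=0$.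
   Context: $D=-i\partial$, so $D_z^\alpha=(-i)^{|\alpha|}\partial_z^\alpha$. The principal symbol $q(z,\zeta)$ is homogeneous polynomial of degree $m$ in $\zeta$, and is evaluated at complex $\zeta\in\mathbb C^N$; $d_{z,\zeta}q$ denotes the differential with respect to all variables $(z,\zeta)$. For $\theta\in\mathbb C^N$, $\theta^\alpha=\prod_j\theta_j^{\alpha_j}$. *)

(* Defs.v *)
From HB Require Import structures.
From mathcomp Require Import all_boot all_order all_algebra.
From mathcomp Require Import all_classical all_reals all_analysis.
From mathcomp.real_closed Require Import complex.

Set Implicit Arguments.
Unset Strict Implicit.
Unset Printing Implicit Defensive.

Import Order.TTheory GRing.Theory Num.Theory numFieldNormedType.Exports.

Local Open Scope classical_set_scope.
Local Open Scope complex_scope.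
Local Open Scope ring_scope.

Section product_with_lebesgue.
Variables (R : realType) (n : nat).
Local Notation mR := (measurableTypeR R).
Variable mu : {sigma_finite_measure set (n.-tuple mR) -> \bar R}.
Local Open Scope ereal_scope.

Definition tuple_cons (p : mR * n.-tuple mR) : n.+1.-tuple mR :=
  [tuple of p.1 :: p.2].

Lemma measurable_tuple_cons : measurable_fun setT tuple_cons.
Proof. exact: measurable_cons. Qed.

Local Notation leb :=
  (lebesgue_measure : {sigma_finite_measure set mR -> \bar R}).

Definition lebesgue_cons := pushforward (leb \x mu) tuple_cons.

Let mtuple_cons A : measurable A -> measurable (tuple_cons @^-1` A).
Proof. by move=> mA; rewrite -[X in measurable X]setTI; exact: measurable_tuple_cons. Qed.

Let lebesgue_cons0 : lebesgue_cons set0 = 0.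
Proof. by rewrite /lebesgue_cons /pushforward preimage_set0 measure0. Qed.

Let lebesgue_cons_ge0 A : 0 <= lebesgue_cons A.
Proof. exact: (measure_ge0 (leb \x mu)). Qed.

Let lebesgue_cons_sigma_additive : semi_sigma_additive lebesgue_cons.
Proof.
move=> F mF tF mUF; rewrite /lebesgue_cons /pushforward preimage_bigcup.
apply: (@measure_semi_sigma_additive _ _ _ (leb \x mu)).
- by move=> k; exact: mtuple_cons.
- apply/trivIsetP => /= i j _ _ ij; rewrite -preimage_setI.
  by move/trivIsetP : tF => /(_ _ _ _ _ ij) ->//; rewrite preimage_set0.
- by rewrite -preimage_bigcup; exact: mtuple_cons.
Qed.

HB.instance Definition _ := isMeasure.Build _ _ _ lebesgue_cons
  lebesgue_cons0 lebesgue_cons_ge0 lebesgue_cons_sigma_additive.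

Let lebesgue_cons_sigma_finite : sigma_finite setT lebesgue_cons.
Proof.
pose h (t : n.+1.-tuple mR) : mR := tnth t ord0.
pose g (t : n.+1.-tuple mR) : n.-tuple mR := [tuple of behead t].
have mh : measurable_fun setT h by exact: measurable_tnth.
have mg : measurable_fun setT g by exact: measurable_behead.
have gK x t : g (tuple_cons (x, t)) = t by exact/val_inj.
have /sigma_finiteP[F [FT ndF Foo]] := sigma_finiteT leb.
have /sigma_finiteP[G [GT ndG Goo]] := sigma_finiteT mu.
exists (fun k => h @^-1` F k `&` g @^-1` G k).
  apply/esym/seteqP; split => // t _.
  have : [set: mR] (h t) by []. have : [set: n.-tuple mR] (g t) by [].
  rewrite FT GT => -[l _ Gl] [k _ Fk]; exists (maxn k l) => //; split.
  - by have /subsetPset := ndF _ _ (leq_maxl k l); apply.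
  - by have /subsetPset := ndG _ _ (leq_maxr k l); apply.
move=> k; have [mF Fk] := Foo k; have [mG Gk] := Goo k; split.
  by apply: measurableI; rewrite -[X in measurable X]setTI; [exact: mh|exact: mg].
have -> : lebesgue_cons (h @^-1` F k `&` g @^-1` G k) =
    (leb \x mu) (F k `*` G k).
  rewrite /lebesgue_cons /pushforward; congr (_ _); apply/seteqP.
  by split => -[x t] /=; rewrite /h gK.
by rewrite product_measure1E// lte_mul_pinfty// ge0_fin_numE.
Qed.

HB.instance Definition _ := Measure_isSigmaFinite.Build _ _ _ lebesgue_cons
  lebesgue_cons_sigma_finite.

End product_with_lebesgue.

(* Lebesgue measure on R^n, as the n-fold product of the Lebesgue measure of R
   on the product sigma-algebra of n.-tuple R. *)
Fixpoint lebesgue_tuple (R : realType) (n : nat) :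
    {sigma_finite_measure set (n.-tuple (measurableTypeR R)) -> \bar R} :=
  match n with
  | 0 => dirac ([tuple] : 0.-tuple (measurableTypeR R))
  | n.+1 => lebesgue_cons (lebesgue_tuple R n)
  end.

Section L2.
Variables (R : realType) (N : nat).

Definition L2norm (f : 'rV[R]_N -> R[i]) : \bar R :=
  Lnorm (lebesgue_tuple R N) 2%:E
    (fun t => (ComplexField.Normc.normc (f (\row_j tnth t j)))%:E).

Definition weighted (tau : R) (phi : 'rV[R]_N -> R) (f : 'rV[R]_N -> R[i]) :
    'rV[R]_N -> R[i] :=
  fun z => (expR (tau * phi z))%:C * f z.

End L2.

Section smooth.
Variables (R : realType) (N : nat).

Definition partial (j : 'I_N) (f : 'rV[R]_N -> R) : 'rV[R]_N -> R :=
  fun z => 'D_('e_j) f z.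

(* C^oo on the set Z, meant for Z open: all iterated partial derivatives, in
   any order, exist and are continuous on Z. *)
Definition smooth_on (Z : set 'rV[R]_N) (f : 'rV[R]_N -> R) : Prop :=
  forall (s : seq 'I_N) (z : 'rV[R]_N), Z z ->
    {for z, continuous (foldr partial f s)} /\
    forall j, derivable (foldr partial f s) z 'e_j.

Definition csmooth_on (Z : set 'rV[R]_N) (f : 'rV[R]_N -> R[i]) : Prop :=
  smooth_on Z (fun z => complex.Re (f z)) /\
  smooth_on Z (fun z => complex.Im (f z)).

Definition cpartial (j : 'I_N) (f : 'rV[R]_N -> R[i]) : 'rV[R]_N -> R[i] :=
  fun z => partial j (fun x => complex.Re (f x)) z +i*
           partial j (fun x => complex.Im (f x)) z.

(* Holomorphic partial derivative: differentiation over the field R[i]. The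
   regular module R[i]^o carries the normed structure of R[i]. *)
Definition hpartial (j : 'I_N) (f : 'rV[R[i]]_N -> R[i])
    (zeta : 'rV[R[i]]_N) : R[i] :=
  'D_('e_j : 'rV[R[i]^o]_N) (f : 'rV[R[i]^o]_N -> R[i]^o) zeta.

Definition csupp (u : 'rV[R]_N -> R[i]) : set 'rV[R]_N :=
  closure [set z | u z != 0].

End smooth.

Section differential_operators.
Variables (R : realType) (N : nat).

Definition multi_index := 'I_N -> nat.

Definition mi_deg (b : multi_index) : nat := (\sum_(j < N) b j)%N.

Definition mi_pow (theta : 'rV[R[i]]_N) (b : multi_index) : R[i] :=
  \prod_(j < N) theta 0 j ^+ b j.

(* D^b = (-i)^|b| d_1^(b_1) ... d_N^(b_N) *)
Definition mi_D (b : multi_index) (f : 'rV[R]_N -> R[i]) : 'rV[R]_N -> R[i] :=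
  fun z => (- 'i) ^+ mi_deg b *
    foldr (fun j g => iter (b j) (cpartial j) g) f (enum 'I_N) z.

(* In the sums below b ranges over the finite type of maps 'I_N -> {0, .., m},
   which contains every multi-index of degree at most m. The values of the
   coefficients a outside the domain of the operator are irrelevant. *)

Definition diffop (m : nat) (a : multi_index -> 'rV[R]_N -> R[i])
    (u : 'rV[R]_N -> R[i]) (z : 'rV[R]_N) : R[i] :=
  \sum_(b : {ffun 'I_N -> 'I_m.+1} | (mi_deg (fun j => b j) <= m)%N)
    a (fun j => b j) z * mi_D (fun j => b j) u z.

Definition principal_symbol (m : nat) (a : multi_index -> 'rV[R]_N -> R[i])
    (z : 'rV[R]_N) (zeta : 'rV[R[i]]_N) : R[i] :=
  \sum_(b : {ffun 'I_N -> 'I_m.+1} | mi_deg (fun j => b j) == m)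
    a (fun j => b j) z * mi_pow zeta (fun j => b j).

(* The differential in all variables (z, zeta), as the row of its partial
   derivatives; q is holomorphic in zeta. *)
Definition diff_symbol (q : 'rV[R]_N -> 'rV[R[i]]_N -> R[i])
    (z : 'rV[R]_N) (zeta : 'rV[R[i]]_N) : 'rV[R[i]]_(N + N) :=
  row_mx (\row_j cpartial j (q^~ zeta) z) (\row_j hpartial j (q z) zeta).

End differential_operators.

(* Main.v *)
Require Import Defs.
From HB Require Import structures.
From mathcomp Require Import all_boot all_order all_algebra.
From mathcomp Require Import all_classical all_reals all_analysis.
From mathcomp.real_closed Require Import complex.
From mathcomp Require Import ring lra.

Set Implicit Arguments.
Unset Strict Implicit.
Unset Printing Implicit Defensive.

Import Order.TTheory GRing.Theory Num.Theory numFieldNormedType.Exports.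

Local Open Scope classical_set_scope.
Local Open Scope complex_scope.
Local Open Scope ring_scope.

(** Wave packets [u = exp(i s^2 <theta0, z - z0>) chi(s (z - z0))] concentrate at
    the characteristic point at scale [1/s], with [tau = tau0 s^2].  A linear
    phase suffices: the exponent of [exp(tau phi) |u|] is
    [tau phi(z0) + tau O(|z - z0|^2)], which stays within a bounded distance of
    [tau phi(z0)] on the support.  In the variable [y = s (z - z0)] the operator
    [s^(-2m) Q] has a two-term expansion in [1/s] whose coefficients are linear
    in [q] and [d q] at [(z0, theta0)], hence vanish; so [Q u = O(s^(2m-2))],
    whereas [D^alpha u] has exact size [s^(2|alpha|)].  The estimate then bounds
    [tau^delta].  The profile [chi] is a product of one-variable bumps, so
    every iterated partial derivative of [u] is again a tensor product. *)

(** The scale is forced from two sides. The quadratic remainder of tau phi at z0 stays bounded only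
    if |z - z0| is of order tau^(-1/2); and the support may not be narrower, since a derivative
    falling on the profile must cost less than one falling on the exponential, s against s^2. At
    width 1/s the symbol is thus probed at distance 1/s from (z0, theta0) in both variables: z = z0
    + y/s perturbs the coefficients, and derivatives of the profile replace theta0 by theta0 +
    D_y/s. A double characteristic then gains s^-2, that is one power of tau, while a term of order
    |b| < m already carries s^(-2(m-|b|)) and is no larger.

    The condition theta0^alpha != 0 keeps the leading term of D^alpha u alive. The remaining factors
    are common to both sides of the estimate and cancel: exp(tau phi(z0)), the square root of a
    volume of order s^-N, and s^(2m-2). *)

(** * An explicit smooth bump and all its derivatives *)

Section bump.
Variable R : realType.
Implicit Types (p q : {poly R}) (t : R).

Lemma regular_scaleE (a b : R) : a *: (b : R^o) = a * b.
Proof. by []. Qed.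

(** A single term of the exponential series is at most the whole sum. *)
Lemma expRN_mul_expn_le (n : nat) (x : R) : 0 <= x ->
  x ^+ n * expR (- x) <= n`!%:R.
Proof.
move=> x0; rewrite expRN ler_pdivrMr ?expR_gt0//.
case: n => [|n].
  by rewrite expr0 fact0 mul1r; apply: le_trans (expR_ge1Dx x); rewrite lerDl.
have := expR_ge1Dxn n x0; set f := (n.+1)`!%:R => h.
have f0 : 0 < f by rewrite ltr0n fact_gt0.
rewrite -ler_pdivrMl// mulrC; apply: le_trans h; lra.
Qed.

(** Used at x = 1/t, where it controls p(1/t) exp(-1/t) as t decreases to 0 and so gives the flat
    functions their derivative at 0. *)
Lemma expRN_mul_horner_bounded p :
  exists K : R, forall x, 0 <= x -> `|p.[x] * expR (- x)| <= K.
Proof.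
exists (\sum_(i < size p) `|p`_i| * i`!%:R) => x x0.
rewrite horner_coef mulr_suml; apply: le_trans (ler_norm_sum _ _ _) _.
apply: ler_sum => i _; rewrite -mulrA normrM ler_wpM2l//.
rewrite ger0_norm; last by rewrite mulr_ge0 ?exprn_ge0 ?expR_ge0.
exact: expRN_mul_expn_le.
Qed.

(** Every derivative of exp(-1/t) is a polynomial in 1/t times exp(-1/t); with the polynomial as a
    parameter, the family is closed under differentiation. *)
Definition flat p t : R := if 0 < t then p.[t^-1] * expR (- t^-1) else 0.

(* [d/dt (p(1/t) exp(-1/t)) = (1/t)^2 (p - p')(1/t) exp(-1/t)] *)
Definition flat_next p : {poly R} := 'X^2 * (p - p^`()).

Lemma flat_le0 p t : t <= 0 -> flat p t = 0.
Proof. by move=> t0; rewrite /flat ltNge t0. Qed.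

Lemma is_derive_flat p t : is_derive t 1 (flat p) (flat (flat_next p) t).
Proof.
have [t0|t0|->] := ltgtP t 0.
- rewrite (flat_le0 _ (ltW t0)).
  apply: (@near_eq_is_derive _ _ _ (cst 0)).
  near=> x; rewrite /= flat_le0// ltW//; near: x.
  exact: lt_nbhsl.
- pose g := fun x : R => p.[x^-1] * expR (- x^-1).
  apply: (@near_eq_is_derive _ _ _ g).
    near=> x; rewrite /flat ifT//; near: x; exact: lt_nbhsr.
  have di : is_derive t (1:R) (fun x : R => x^-1) (- t ^- 2 *: 1).
    by apply: (@is_deriveV R id) => //; rewrite gt_eqF.
  have dN : is_derive t (1:R) (fun x : R => - x^-1) (- (- t ^- 2 *: 1)).
    exact: is_deriveN.
  have d1 := @is_derive1_comp R (horner p) (fun x => x^-1) t _ _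
    (is_derive_poly p t^-1) di.
  have d2 := @is_derive1_comp R expR (fun x => - x^-1) t _ _
    (is_derive_expR (- t^-1)) dN.
  apply: (is_derive_eq (is_deriveM d1 d2)).
  rewrite /flat t0 /flat_next !regular_scaleE !hornerE !exprVn /=; ring.
- rewrite flat_le0//.
  (* The factor X^2 absorbs the division by h: for h > 0 the difference quotient is h times (X^2
     p)(1/h) exp(-1/h), hence at most K |h|. *)
  have [K HK] := expRN_mul_horner_bounded ('X^2 * p).
  have K0 : 0 <= K by apply: le_trans (HK 0 _).
  suff H : h^-1 *: (flat p (h *: 1 + 0) - flat p 0) @[h --> (0:R)^'] --> (0:R).
    apply: (DeriveDef _ (cvg_lim _ H)) => //.
    by apply/cvg_ex; exists 0.
  apply/cvgrPdist_lt => e e0; near=> h.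
  have h0 : h != 0 by near: h; exact: nbhs_dnbhs_neq.
  rewrite sub0r normrN addr0 (flat_le0 p (lexx 0)) subr0 !regular_scaleE mulr1.
  apply: (@le_lt_trans _ _ (K * `|h|)).
    rewrite /flat; case: ifPn => [hp|]; last by rewrite mulr0 normr0 mulr_ge0.
    have := HK h^-1; rewrite invr_ge0 (ltW hp) => /(_ isT) /(ler_wpM2l (normr_ge0 h)).
    rewrite -normrM [K * _]mulrC; apply: le_trans.
    rewrite hornerM hornerXn (_ : h * _ = h^-1 * (p.[h^-1] * expR (- h^-1)))//.
    by field.
  rewrite (@le_lt_trans _ _ ((K + 1) * `|h|))//; first by rewrite ler_wpM2r ?lerDl.
  rewrite -ltr_pdivlMl ?ltr_wpDl// mulrC; near: h.
  apply: (@dnbhs0_lt _ _ (e / (K + 1))); by rewrite divr_gt0 ?ltr_wpDl.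
Unshelve. all: by end_near. Qed.

(* Sums of products of flat functions at the two endpoints of [-1, 1]: this
   class is closed under differentiation and contains the bump. *)
Definition bump_sum (l : seq ({poly R} * {poly R})) t : R :=
  \sum_(pq <- l) flat pq.1 (1 - t) * flat pq.2 (1 + t).

(** Leibniz rule; the sign comes from the inner derivative of [1 - t]. *)
Definition bump_next (l : seq ({poly R} * {poly R})) :=
  flatten [seq [:: (- flat_next pq.1, pq.2); (pq.1, flat_next pq.2)] | pq <- l].

(** The c-th derivative of the function equal to exp(-2/(1 - t^2)) on (-1, 1) and to 0 elsewhere. *)
Definition bump (c : nat) : R -> R := bump_sum (iter c bump_next [:: (1, 1)]).

Lemma flatN p t : flat (- p) t = - flat p t.
Proof. by rewrite /flat hornerN; case: ifP => _; rewrite ?oppr0 ?mulNr. Qed.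

Lemma is_derive_bump_sum l t :
  is_derive t 1 (bump_sum l) (bump_sum (bump_next l) t).
Proof.
elim: l => [|[p q] l IH].
  have -> : bump_sum [::] = cst 0 by apply/funext => x; rewrite /bump_sum big_nil.
  exact: (@is_derive_cst R R R 0 t 1).
have -> : bump_sum ((p, q) :: l) =
    (fun x => flat p (1 - x)) * (fun x => flat q (1 + x)) + bump_sum l.
  by apply/funext => x; rewrite /bump_sum big_cons.
have dN : is_derive t (1:R) (fun x => 1 - x : R) (0 - 1) by exact: is_deriveB.
have dD : is_derive t (1:R) (fun x => 1 + x : R) (0 + 1) by exact: is_deriveD.
have d1 := @is_derive1_comp R (flat p) _ t _ _ (is_derive_flat p (1 - t)) dN.
have d2 := @is_derive1_comp R (flat q) _ t _ _ (is_derive_flat q (1 + t)) dD.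
apply: (is_derive_eq (is_deriveD (is_deriveM d1 d2) IH)).
by rewrite {2}/bump_sum /bump_next /= !big_cons /= flatN -/bump_next -/(bump_sum _ _) !regular_scaleE; ring.
Qed.

Lemma is_derive_bump c t : is_derive t 1 (bump c) (bump c.+1 t).
Proof. exact: is_derive_bump_sum. Qed.

Lemma bump_out c t : 1 <= `|t| -> bump c t = 0.
Proof.
move=> t1; rewrite /bump /bump_sum big1 => // pq _.
have [t0|t0] := leP 0 t.
  by rewrite (@flat_le0 _ (1 - t)) ?mul0r// subr_le0; move: t1; rewrite ger0_norm.
rewrite (@flat_le0 _ (1 + t)) ?mulr0//; move: t1; rewrite ltr0_norm//; lra.
Qed.

Lemma bump0_gt0 : 0 < bump 0 0.
Proof.
rewrite /bump /bump_sum /= big_seq1 /flat subr0 addr0 ltr01 hornerC mul1r.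
by rewrite mulr_gt0 ?expR_gt0.
Qed.

Lemma continuous_bump c : continuous (bump c).
Proof.
move=> t; apply/differentiable_continuous/derivable1_diffP.
exact: (@ex_derive _ _ _ _ _ _ _ (is_derive_bump c t)).
Qed.

Lemma bump_bounded c : exists K : R, forall t, `|bump c t| <= K.
Proof.
have cw : {within `[-1, 1]%classic, continuous (fun t => `|bump c t|)}.
  apply: continuous_subspaceT => t.
  by apply: continuous_comp; [exact: continuous_bump|exact: norm_continuous].
have [|x _ Hx] := EVT_max _ cw; first lra.
exists (`|bump c x|) => t.
have [t1|t1] := leP `|t| 1; first by apply: Hx; rewrite in_itv /= -ler_norml.
by rewrite bump_out ?normr0 // ltW.
Qed.

(** Supplies the region on which the packet has a definite size, for the lower bound on D^alpha
    u. *)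
Lemma bump0_lower : exists2 r : R, 0 < r &
  forall t, `|t| <= r -> bump 0 0 / 2 <= bump 0 t.
Proof.
have /cvgrPdist_le/(_ (bump 0 0 / 2)) := @continuous_bump 0 0.
rewrite divr_gt0 ?bump0_gt0// => /(_ isT) /nbhs_ballP [r /= r0 Hr].
exists (r / 2); first by rewrite divr_gt0.
move=> t tr; have /Hr : ball (0:R) r t.
  rewrite /ball /= sub0r normrN; apply: le_lt_trans tr _.
  by rewrite ltr_pdivrMr// mulr_natr mulr2n ltrDl.
by rewrite ler_norml => /andP[_]; lra.
Qed.

End bump.

(** * Complex-valued functions of one real variable *)

Section complex_derivative.
Variable R : realType.
Local Notation Re := complex.Re.
Local Notation Im := complex.Im.

Lemma ReD (x y : R[i]) : Re (x + y) = Re x + Re y.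
Proof. by case: x; case: y. Qed.

Lemma ImD (x y : R[i]) : Im (x + y) = Im x + Im y.
Proof. by case: x; case: y. Qed.

Lemma ReM (x y : R[i]) : Re (x * y) = Re x * Re y - Im x * Im y.
Proof. by case: x; case: y. Qed.

Lemma ImM (x y : R[i]) : Im (x * y) = Re x * Im y + Im x * Re y.
Proof. by case: x; case: y. Qed.

(** Split into real and imaginary parts to match [cpartial]. *)
Definition is_cderive (t : R) (f : R -> R[i]) (l : R[i]) : Prop :=
  is_derive t 1 (fun x => Re (f x)) (Re l) /\
  is_derive t 1 (fun x => Im (f x)) (Im l).

Lemma is_derive_ext (V : normedModType R) (x v : V) (f g : V -> R) (l l' : R) :
  f =1 g -> l = l' -> is_derive x v f l -> is_derive x v g l'.
Proof. by move=> /funext -> ->. Qed.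

Lemma is_cderive_cst (t : R) (c : R[i]) : is_cderive t (fun _ => c) 0.
Proof. by split; apply: is_derive_cst. Qed.

Lemma is_cderiveD t f g l k : is_cderive t f l -> is_cderive t g k ->
  is_cderive t (fun x => f x + g x) (l + k).
Proof.
move=> [fr fi] [gr gi]; split.
- apply: is_derive_ext (is_deriveD fr gr) => [x|]; by rewrite ?fctE ReD.
- apply: is_derive_ext (is_deriveD fi gi) => [x|]; by rewrite ?fctE ImD.
Qed.

Lemma is_cderiveM t f g l k : is_cderive t f l -> is_cderive t g k ->
  is_cderive t (fun x => f x * g x) (l * g t + f t * k).
Proof.
move=> [fr fi] [gr gi]; split.
- apply: is_derive_ext (is_deriveB (is_deriveM fr gr) (is_deriveM fi gi)) => [x|].
    by rewrite /= ReM.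
  by rewrite !regular_scaleE ReD !ReM; ring.
- apply: is_derive_ext (is_deriveD (is_deriveM fr gi) (is_deriveM fi gr)) => [x|].
    by rewrite /= ImM.
  by rewrite !regular_scaleE ImD !ImM; ring.
Qed.

Lemma is_cderiveZ t c f l : is_cderive t f l ->
  is_cderive t (fun x => c * f x) (c * l).
Proof.
move=> df; have := is_cderiveM (is_cderive_cst t c) df.
by rewrite mul0r add0r.
Qed.

Lemma is_cderive_real (t l : R) (f : R -> R) : is_derive t 1 f l ->
  is_cderive t (fun x => (f x)%:C) l%:C.
Proof. by move=> df; split => //=; apply: is_derive_cst. Qed.

Lemma is_derive_affine (s t0 t : R) (f : R -> R) (l : R) :
  is_derive (s * (t - t0)) 1 f l ->
  is_derive t 1 (fun x => f (s * (x - t0))) (s * l).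
Proof.
move=> df.
have da : is_derive t (1:R) (fun x => s * (x - t0)) s.
  have /= := is_deriveZ s (is_deriveB (is_derive_id t (1:R)) (is_derive_cst t0 t (1:R))).
  by apply: is_derive_ext => //; rewrite regular_scaleE subr0 mulr1.
have dc := @is_derive1_comp R f (fun x => s * (x - t0)) t l s df da.
by apply: is_derive_ext dc; rewrite // mulrC.
Qed.

Lemma is_cderive_affine (s t0 t : R) f l : is_cderive (s * (t - t0)) f l ->
  is_cderive t (fun x => f (s * (x - t0))) (s%:C * l).
Proof.
move=> [fr fi]; split.
- apply: is_derive_ext (is_derive_affine fr) => //.
  by rewrite ReM /= mul0r subr0.
- apply: is_derive_ext (is_derive_affine fi) => //.
  by rewrite ImM /= mul0r addr0.
Qed.

Definition cexp (c : R[i]) : R[i] :=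
  expR (Re c) * cos (Im c) +i* (expR (Re c) * sin (Im c)).

Lemma is_cderive_cexp (c : R[i]) (t : R) :
  is_cderive t (fun x => cexp (c * x%:C)) (c * cexp (c * t%:C)).
Proof.
have aff (f : R -> R) (b l : R) : is_derive (b * t) 1 f l ->
    is_derive t 1 (fun x => f (b * x)) (b * l).
  move=> df; have := @is_derive_affine b 0 t f l; rewrite subr0 => /(_ df).
  by apply: is_derive_ext => // x; rewrite subr0.
have dE := aff _ (Re c) _ (is_derive_expR (Re c * t)).
have dC := aff _ (Im c) _ (is_derive_cos (Im c * t)).
have dS := aff _ (Im c) _ (is_derive_sin (Im c * t)).
have EE x : cexp (c * x%:C) =
    expR (Re c * x) * cos (Im c * x) +i* (expR (Re c * x) * sin (Im c * x)).
  by rewrite /cexp ReM ImM /= !mulr0 subr0 add0r.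
split.
- apply: is_derive_ext (is_deriveM dE dC) => [x|]; first by rewrite EE.
  by rewrite EE !regular_scaleE ReM /=; ring.
- apply: is_derive_ext (is_deriveM dE dS) => [x|]; first by rewrite EE.
  by rewrite EE !regular_scaleE ImM /=; ring.
Qed.

Lemma normc_cexp (c : R[i]) : ComplexField.Normc.normc (cexp c) = expR (Re c).
Proof.
rewrite /ComplexField.Normc.normc /cexp !exprMn -mulrDr cos2Dsin2 mulr1.
by rewrite sqrtr_sqr ger0_norm ?expR_ge0.
Qed.

End complex_derivative.

(** Both derivatives are limits of the same difference quotient. The field is left general because
    real partials and holomorphic ones both go through this reduction. *)
Lemma is_derive_lineP (K : numFieldType) (N : nat) (f : 'rV[K]_N -> K)
    (g : K -> K) (j : 'I_N) (z : 'rV[K]_N) (t l : K) :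
  (forall h, f (h *: 'e_j + z) = g (h + t)) ->
  is_derive t 1 g l <-> is_derive z 'e_j f l.
Proof.
move=> fg.
have E : (fun h : K => h^-1 *: (f (h *: 'e_j + z) - f z)) =
         (fun h => h^-1 *: (g (h *: 1 + t) - g t)).
  apply/funext => h; rewrite fg; congr (_ *: (g (_ + _) - _)).
    exact: (esym (mulr1 h)).
  by have := fg 0; rewrite scale0r !add0r.
by split=> -[dg dgl]; apply: DeriveDef; move: dg dgl; rewrite /derivable /derive E.
Qed.

(** * Tensor products of one-variable functions and their partial derivatives *)

Section tensor_products.
Variables (R : realType) (N : nat).
Local Notation Re := complex.Re.
Local Notation Im := complex.Im.
Implicit Types (z : 'rV[R]_N) (j : 'I_N).

Variable W : 'I_N -> nat -> R -> R[i].
Hypothesis dW : forall j n t, is_cderive t (W j n) (W j n.+1 t).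

(** [W j n] is the n-th derivative of the j-th factor, so a partial derivative merely increments the
    multi-index [b]. *)
Definition tensor (b : 'I_N -> nat) z : R[i] := \prod_j W j (b j) (z 0 j).

Definition mi_incr j (b : 'I_N -> nat) : 'I_N -> nat :=
  fun k => (b k + (k == j))%N.

Lemma is_derive_tensor j b z :
  is_derive z 'e_j (fun x => Re (tensor b x)) (Re (tensor (mi_incr j b) z)) /\
  is_derive z 'e_j (fun x => Im (tensor b x)) (Im (tensor (mi_incr j b) z)).
Proof.
set c := \prod_(k < N | k != j) W k (b k) (z 0 k).
have bE h : tensor b (h *: 'e_j + z) = W j (b j) (h + z 0 j) * c.
  rewrite /tensor (bigD1 j)//= !mxE !eqxx mulr1; congr (_ * _).
  by apply: eq_bigr => k kj; rewrite !mxE /= (negbTE kj) mulr0 add0r.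
have iE : tensor (mi_incr j b) z = W j (b j).+1 (z 0 j) * c.
  rewrite /tensor (bigD1 j)//= /mi_incr eqxx addn1; congr (_ * _).
  by apply: eq_bigr => k kj; rewrite (negbTE kj) addn0.
have := is_cderiveM (dW j (b j) (z 0 j)) (is_cderive_cst (z 0 j) c).
rewrite mulr0 addr0 -iE => -[dr di]; split.
- have := iffLR (@is_derive_lineP R N (fun x => Re (tensor b x)) _ j z (z 0 j) _ _) dr.
  by apply=> h; rewrite bE.
- have := iffLR (@is_derive_lineP R N (fun x => Im (tensor b x)) _ j z (z 0 j) _ _) di.
  by apply=> h; rewrite bE.
Qed.

Lemma partial_tensor j b :
  partial j (fun x => Re (tensor b x)) = (fun x => Re (tensor (mi_incr j b) x)) /\
  partial j (fun x => Im (tensor b x)) = (fun x => Im (tensor (mi_incr j b) x)).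
Proof.
by split; apply/funext => z; rewrite /partial;
  [apply: (@derive_val _ _ _ _ _ _ _ (is_derive_tensor j b z).1)
  |apply: (@derive_val _ _ _ _ _ _ _ (is_derive_tensor j b z).2)].
Qed.

Lemma cpartial_tensor j b : cpartial j (tensor b) = tensor (mi_incr j b).
Proof.
apply/funext => z; rewrite /cpartial (partial_tensor j b).1 (partial_tensor j b).2.
by case: tensor.
Qed.

Lemma continuous_tensor b :
  continuous (fun z => Re (tensor b z)) /\ continuous (fun z => Im (tensor b z)).
Proof.
rewrite /tensor; elim: (index_enum _) => [|j s [IHr IHi]].
  have E z : \prod_(j <- [::]) W j (b j) (z 0 j) = 1 by rewrite big_nil.
  split.
    have -> : (fun z => Re (\prod_(j <- [::]) W j (b j) (z 0 j))) = cst 1.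
      by apply/funext => z; rewrite E.
    by move=> z; exact: cst_continuous.
  have -> : (fun z => Im (\prod_(j <- [::]) W j (b j) (z 0 j))) = cst 0.
    by apply/funext => z; rewrite E.
  by move=> z; exact: cst_continuous.
have cr : continuous (fun z : 'rV[R]_N => Re (W j (b j) (z 0 j))).
  move=> z; apply: (@continuous_comp _ _ _ (fun z : 'rV[R]_N => z 0 j)
    (fun t => Re (W j (b j) t))); first exact: coord_continuous.
  apply/differentiable_continuous/derivable1_diffP.
  exact: (@ex_derive _ _ _ _ _ _ _ (dW j (b j) _).1).
have ci : continuous (fun z : 'rV[R]_N => Im (W j (b j) (z 0 j))).
  move=> z; apply: (@continuous_comp _ _ _ (fun z : 'rV[R]_N => z 0 j)
    (fun t => Im (W j (b j) t))); first exact: coord_continuous.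
  apply/differentiable_continuous/derivable1_diffP.
  exact: (@ex_derive _ _ _ _ _ _ _ (dW j (b j) _).2).
split.
- under eq_fun do rewrite big_cons ReM.
  by move=> z; exact: (cvgB (cvgM (cr z) (IHr z)) (cvgM (ci z) (IHi z))).
- under eq_fun do rewrite big_cons ImM.
  by move=> z; exact: (cvgD (cvgM (cr z) (IHi z)) (cvgM (ci z) (IHr z))).
Qed.

Lemma csmooth_tensor b : csmooth_on setT (tensor b).
Proof.
have E s : exists b',
    foldr (@partial R N) (fun z => Re (tensor b z)) s = (fun z => Re (tensor b' z)) /\
    foldr (@partial R N) (fun z => Im (tensor b z)) s = (fun z => Im (tensor b' z)).
  elim: s => [|j s [b' [/= -> ->]]]; first by exists b.
  by exists (mi_incr j b'); case: (partial_tensor j b').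
split=> s z _; have [b' [Er Ei]] := E s.
- rewrite Er; split; first exact: (continuous_tensor b').1.
  by move=> j; exact: (@ex_derive _ _ _ _ _ _ _ (is_derive_tensor j b' z).1).
- rewrite Ei; split; first exact: (continuous_tensor b').2.
  by move=> j; exact: (@ex_derive _ _ _ _ _ _ _ (is_derive_tensor j b' z).2).
Qed.

Lemma mi_D_tensor b : mi_D b (tensor (fun _ => 0)) =
  fun z => (- 'i) ^+ mi_deg b * tensor b z.
Proof.
apply/funext => z; rewrite /mi_D; congr (_ * _).
have iterE j n b' : iter n (@cpartial R N j) (tensor b') =
    tensor (fun k => (b' k + (if k == j then n else 0))%N).
  elim: n => [|n /= ->].
    by congr tensor; apply/funext => k; case: ifP; rewrite addn0.
  rewrite cpartial_tensor; congr tensor; apply/funext => k; rewrite /mi_incr.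
  by case: eqP => _; rewrite -addnA ?addn1 ?addn0.
(* Uniqueness of [s] makes each coordinate contribute its [b k] only once. *)
have foldE s b' : uniq s ->
    foldr (fun j g => iter (b j) (@cpartial R N j) g) (tensor b') s =
    tensor (fun k => (b' k + (if k \in s then b k else 0))%N).
  elim: s => [|j s IH] /=; first by move=> _; congr tensor; apply/funext => k; rewrite addn0.
  move=> /andP[js us]; rewrite IH// iterE; congr tensor; apply/funext => k.
  rewrite inE; have [->|kj] := eqVneq k j; last by rewrite /= addn0.
  by rewrite (negbTE js) addn0.
rewrite foldE ?enum_uniq//; congr tensor; apply/funext => k.
by rewrite mem_enum.
Qed.

End tensor_products.

(** * Second-order Taylor estimate on boxes *)

Section taylor.
Variables (R : realType) (N : nat).
Implicit Types (z : 'rV[R]_N) (f : 'rV[R]_N -> R) (j : 'I_N).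

(** Closed boxes fit both the support of a product of bumps and a product of intervals, whose
    measure is explicit. *)
Definition box z (r : R) : set 'rV[R]_N :=
  [set x | forall j, `|x 0 j - z 0 j| <= r].

Lemma nbhs_box z (P : set 'rV[R]_N) : nbhs z P ->
  exists2 r : R, 0 < r & box z r `<=` P.
Proof.
move=> /nbhs_ballP[r /= r0 rP]; exists (r / 2); first by rewrite divr_gt0.
move=> x xr; apply: rP; split=> // i j; rewrite (ord1 i) /ball /= distrC.
apply: le_lt_trans (xr j) _.
by rewrite ltr_pdivrMr// mulr_natr mulr2n ltrDl.
Qed.

Lemma le_box z (r r' : R) : r <= r' -> box z r `<=` box z r'.
Proof. by move=> rr x xr j; exact: le_trans (xr j) rr. Qed.

Lemma mvt_le (g dg : R -> R) (a b K : R) :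
  (forall t, Num.min a b <= t <= Num.max a b ->
    is_derive t 1 g (dg t) /\ `|dg t| <= K) ->
  `|g b - g a| <= K * `|b - a|.
Proof.
wlog ab : a b / a <= b => [hw H|].
  have [ab|/ltW ba] := leP a b; first exact: hw.
  by rewrite distrC [`|b - a|]distrC; apply: hw => // t; rewrite minC maxC; exact: H.
rewrite min_l// max_r// => H.
have dg_oo x : x \in `]a, b[ -> is_derive x 1 g (dg x).
  by move=> xab; have [] := H x; rewrite // !ltW ?(itvP xab).
have cg : {within `[a, b], continuous g}.
  apply: derivable_within_continuous => x; rewrite in_itv /= => xab.
  by have [dx _] := H x xab; exact: (@ex_derive _ _ _ _ _ _ _ dx).
have [c cab ->] := MVT_segment ab dg_oo cg.
by rewrite normrM ler_wpM2r//; have [] := H c.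
Qed.

(** Changing one coordinate at a time leads from [z0] to [z] along N axis-parallel segments inside
    the box; each is handled by the one-variable mean value theorem, so partial derivatives
    suffice. *)
Lemma box_mvt_le f z0 (r K : R) z : 0 <= K ->
  (forall x, box z0 r x -> forall j, derivable f x 'e_j /\ `|partial j f x| <= K) ->
  box z0 r z -> `|f z - f z0| <= N%:R * K * r.
Proof.
move=> K0 H zr.
pose p k : 'rV[R]_N := \row_j (if (j < k)%N then z 0 j else z0 0 j).
have -> : f z = f (p N).
  by congr f; apply/rowP => j; rewrite mxE ltn_ord.
have -> : f z0 = f (p 0) by congr f; apply/rowP => j; rewrite mxE.
rewrite -(telescope_sumr (fun k => f (p k)))//.
rewrite (big_mkord predT (fun k => f (p k.+1) - f (p k))).
apply: le_trans (ler_norm_sum _ _ _) _.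
rewrite -mulrA -[N in N%:R]card_ord mulr_natl -sumr_const; apply: ler_sum => j _.
pose x t : 'rV[R]_N := \row_k (if k == j then t else p j 0 k).
have xj : x (z 0 j) = p j.+1.
  apply/rowP => k; rewrite !mxE ltnS [(k <= j)%N]leq_eqVlt.
  by have -> : (k == j :> nat) = (k == j) by []; case: eqVneq => [->|].
have xj0 : x (z0 0 j) = p j.
  by apply/rowP => k; rewrite !mxE; case: eqP => // ->; rewrite ltnn.
rewrite -xj -xj0; apply: le_trans (_ : K * `|z 0 j - z0 0 j| <= _); last first.
  by rewrite ler_wpM2l.
apply: (@mvt_le (f \o x) (fun t => partial j f (x t))) => t tz.
have r0 : 0 <= r by apply: le_trans (zr j).
have xr : box z0 r (x t).
  move=> k; rewrite !mxE; case: eqP => [->|_]; last first.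
    by case: ifP => _; rewrite ?subrr ?normr0.
  move: (zr j) tz; rewrite !ler_norml.
  by case: (leP (z0 0 j) (z 0 j)) => _ /andP[? ?] /andP[? ?]; apply/andP; split; lra.
have [dx xK] := H _ xr j; split; last exact: xK.
apply/(@is_derive_lineP _ _ f _ j (x t)).
  move=> h /=; congr f; apply/rowP => k; rewrite !mxE /=.
  by case: eqP => _; rewrite ?mulr1 ?mulr0 ?add0r.
by split.
Qed.

Lemma is_derive_coord j k z : is_derive z 'e_j (fun x => x 0 k) ((k == j)%:R : R).
Proof.
have [->|kj] := eqVneq k j.
  apply/(@is_derive_lineP _ _ _ id j z (z 0 j)).
    by move=> h; rewrite !mxE !eqxx mulr1.
apply/(@is_derive_lineP _ _ _ (cst (z 0 k)) j z 0).
  by move=> h; rewrite !mxE /= (negbTE kj) mulr0 add0r.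
Qed.

(** The mean value bound is applied twice: to [f] minus its linear part, whose partials vanish at
    [z0], and to those partials themselves. Each application yields one factor N and one factor
    [e]. *)
Lemma smooth_taylor (Z : set 'rV[R]_N) f z0 : open Z -> Z z0 -> smooth_on Z f ->
  exists r K : R, [/\ 0 < r, 0 <= K, box z0 r `<=` Z & forall z e, 0 <= e <= r -> box z0 e z ->
    `|f z - f z0 - \sum_j partial j f z0 * (z 0 j - z0 0 j)| <= K * e ^+ 2].
Proof.
move=> oZ Zz0 sf.
(* By continuity each second partial stays near [z0] below its own value there plus 1; the sum
   dominates them all at once. *)
pose M := \sum_i \sum_j (`|partial i (partial j f) z0| + 1).
have M0 : 0 <= M by do 2! apply: sumr_ge0 => ? _; rewrite addr_ge0.
have nZ : \forall x \near z0, Z x by exact: open_nbhs_nbhs.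
have nM : \forall x \near z0,
    forall ij : 'I_N * 'I_N, `|partial ij.1 (partial ij.2 f) x| <= M.
  apply: (@filter_forall _ _ (fun ij x => `|partial ij.1 (partial ij.2 f) x| <= M)
    (nbhs z0)) => -[i j] /=.
  have [cf _] := sf [:: i; j] _ Zz0.
  have /cvgrPdist_le/(_ 1 ltr01) := cf.
  apply: filterS => x /= xle.
  apply: (@le_trans _ _ (`|partial i (partial j f) z0| + 1)).
    rewrite -lerBlDl; apply: le_trans (lerB_dist _ _) _; by rewrite distrC.
  pose c i j := `|partial i (partial j f) z0| + 1.
  have c0 k l : 0 <= c k l by rewrite addr_ge0.
  apply: (@le_trans _ _ (\sum_l c i l)).
    by rewrite (bigD1 j)//= lerDl sumr_ge0.
  have -> : M = \sum_k \sum_l c k l by [].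
  rewrite [leRHS](bigD1 i)//= lerDl sumr_ge0// => k _.
  by rewrite sumr_ge0// => l _; exact: c0.
have [r r0 rM] := nbhs_box (filterI nZ nM).
exists r, (N%:R * (N%:R * M)); split => //.
- by rewrite !mulr_ge0.
- by move=> x /rM[].
move=> z e /andP[e0 er] ze.
pose g x := f x - \sum_j partial j f z0 * x 0 j.
have dg x j : Z x -> is_derive x 'e_j g (partial j f x - partial j f z0).
  move=> Zx; have [_ /(_ j)/derivableP df] := sf [::] _ Zx.
  have ds : is_derive x 'e_j (\sum_k (partial k f z0 *: (fun x : 'rV[R]_N => x 0 k)))
      (\sum_k partial k f z0 *: ((k == j)%:R : R)).
    by apply: is_derive_sum => k; apply: is_deriveZ; exact: is_derive_coord.
  apply: is_derive_ext (is_deriveB df ds) => [y|].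
    by rewrite /g !fctE fct_sumE.
  congr (_ - _); rewrite (bigD1 j)//= eqxx regular_scaleE mulr1 big1 ?addr0// => k kj.
  by rewrite (negbTE kj) regular_scaleE mulr0.
have -> : f z - f z0 - \sum_j partial j f z0 * (z 0 j - z0 0 j) = g z - g z0.
  rewrite /g; under eq_bigr do rewrite mulrBr.
  by rewrite sumrB; ring.
have -> : N%:R * (N%:R * M) * e ^+ 2 = N%:R * (N%:R * M * e) * e by ring.
apply: box_mvt_le ze; first by rewrite !mulr_ge0.
move=> x xe j; have [Zx xM] := rM _ (le_box er xe).
have dgx := dg x j Zx; split; first exact: (@ex_derive _ _ _ _ _ _ _ dgx).
rewrite /partial (@derive_val _ _ _ _ _ _ _ dgx).
apply: box_mvt_le xe => // y ye i; have [Zy yM] := rM _ (le_box er ye); split.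
  by have [_ /(_ i)] := sf [:: j] _ Zy.
exact: (yM (i, j)).
Qed.

End taylor.

(** * Lebesgue measure of boxes *)

Section box_measure.
Variable R : realType.
Local Notation mR := (measurableTypeR R).

Definition tuple_box (n : nat) (c : 'I_n -> R) (r : R) : set (n.-tuple mR) :=
  [set t | forall j, `|tnth t j - c j| <= r].

Lemma measurable_tuple_box n (c : 'I_n -> R) r : measurable (tuple_box c r).
Proof.
have -> : tuple_box c r = \bigcap_(j in [set: 'I_n])
    ((fun t : n.-tuple mR => tnth t j) @^-1` `[c j - r, c j + r]%classic).
  apply/seteqP; split=> [t tr j _|t tr j].
    by rewrite /= in_itv /= -ler_distl.
  by have := tr j I; rewrite /= in_itv /= -ler_distl.
apply: fin_bigcap_measurable => [|j _]; first exact: finite_finset.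
rewrite -[X in measurable X]setTI; exact: measurable_tnth.
Qed.

Lemma lebesgue_tuple_box n (c : 'I_n -> R) r : 0 <= r ->
  lebesgue_tuple R n (tuple_box c r) = ((2 * r) ^+ n)%:E.
Proof.
move=> r0; elim: n c => [|n IH] c.
  rewrite /= diracE mem_set ?expr0//; by case.
pose c' (j : 'I_n) := c (lift ord0 j).
have E : @tuple_cons R n @^-1` (tuple_box c r) =
    `[c ord0 - r, c ord0 + r]%classic `*` tuple_box c' r.
  apply/seteqP; split=> -[x t] /=.
    move=> H; split.
      by have := H ord0; rewrite in_itv /= -ler_distl.
    by move=> j; have := H (lift ord0 j); rewrite tnthS.
  move=> [x0 tr] j; case: (unliftP ord0 j) => [i ->|->].
    by rewrite tnthS; exact: tr.
  by move: x0; rewrite in_itv /= -ler_distl.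
rewrite [LHS](_ : _ = (lebesgue_measure \x lebesgue_tuple R n)%E
   (@tuple_cons R n @^-1` (tuple_box c r)))// E.
rewrite product_measure1E//; last exact: measurable_tuple_box.
rewrite IH; have := @lebesgue_measure_itv R `[c ord0 - r, c ord0 + r]; rewrite /= lte_fin.
set l := (X in X = _ -> _) => lE; rewrite [X in (X * _)%E](_ : _ = l)//; rewrite {}lE.
case: ifPn => [_|].
  rewrite -EFinB -EFinM exprS; congr (_ * _)%:E; ring.
(* The degenerate interval: [r = 0], and both sides vanish because the dimension is [n.+1]. *)
rewrite -leNgt => r0'; have -> : r = 0 by apply/eqP; rewrite eq_le r0 andbT; lra.
by rewrite mul0e mulr0 expr0n.
Qed.

End box_measure.

(** * Bounds on L^2 norms by constants on boxes *)

Section L2_bounds.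
Variables (R : realType).
Local Notation normc := ComplexField.Normc.normc.

(** The integral of a nonnegative function is a supremum over the simple functions below it, and
    this is monotone in the function. Weighted packets can thus be compared with constants on boxes
    without proving them measurable. *)
Lemma le_integral_nonmeasurable d (T : measurableType d)
    (mu : {measure set T -> \bar R}) (f g : T -> \bar R) :
  (forall x, 0 <= f x)%E -> (forall x, f x <= g x)%E ->
  (\int[mu]_x f x <= \int[mu]_x g x)%E.
Proof.
move=> f0 fg; rewrite !ge0_integralTE// => [|x]; last exact: le_trans (fg x).
apply: le_ereal_sup => _ [h hf <-]; exists h => // x.
exact: le_trans (hf x) (fg x).
Qed.

Lemma integral_cst_on d (T : measurableType d) (mu : {measure set T -> \bar R})
    (D : set T) (K : R) : measurable D ->
  (\int[mu]_x ((cst K%:E \_ D) x) = K%:E * mu D)%E.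
Proof. by move=> mD; rewrite -integral_mkcond integral_cst. Qed.

Variable N : nat.
Implicit Types (f : 'rV[R]_N -> R[i]) (z : 'rV[R]_N).

Lemma normc_ge0 (x : R[i]) : 0 <= normc x.
Proof. by case: x => a b; exact: sqrtr_ge0. Qed.

Lemma L2normE f : L2norm f =
  ((\int[lebesgue_tuple R N]_t ((normc (f (\row_j tnth t j)) ^+ 2)%:E)) `^ 2^-1)%E.
Proof.
rewrite /L2norm unlock; congr (_ `^ _)%E; apply: eq_integral => t _.
by rewrite gee0_abs ?lee_fin ?normc_ge0// poweR_EFin powR_mulrn ?normc_ge0.
Qed.

Lemma box_of_tuple z0 (r : R) (t : N.-tuple (measurableTypeR R)) :
  tuple_box (fun j => z0 0 j) r t <-> box z0 r (\row_j tnth t j).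
Proof. by split=> H j; have := H j; rewrite ?mxE. Qed.

Lemma sqrt_volume (M r : R) : 0 <= M -> 0 <= r ->
  (((M ^+ 2)%:E * ((2 * r) ^+ N)%:E) `^ 2^-1 = (M * Num.sqrt ((2 * r) ^+ N))%:E)%E.
Proof.
move=> M0 r0; have v0 : 0 <= (2 * r) ^+ N by rewrite exprn_ge0// mulr_ge0.
rewrite -EFinM poweR_EFin powR12_sqrt ?mulr_ge0 ?sqr_ge0//.
by rewrite sqrtrM ?sqr_ge0// sqrtr_sqr ger0_norm.
Qed.

Lemma poweR_half_le (x y : \bar R) : (0 <= x)%E -> (x <= y)%E ->
  (x `^ 2^-1 <= y `^ 2^-1)%E.
Proof.
move=> x0 xy; apply: gt0_ler_poweR => //; rewrite ?invr_ge0// in_itv /= leey andbT//.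
exact: le_trans xy.
Qed.

Lemma L2norm_le f z0 (r M : R) : 0 <= r -> 0 <= M ->
  (forall z, box z0 r z -> normc (f z) <= M) ->
  (forall z, ~ box z0 r z -> f z = 0) ->
  (L2norm f <= (M * Num.sqrt ((2 * r) ^+ N))%:E)%E.
Proof.
move=> r0 M0 fM fout; rewrite L2normE -sqrt_volume// -(lebesgue_tuple_box (fun j => z0 0 j) r0).
rewrite -integral_cst_on; last exact: measurable_tuple_box.
apply: poweR_half_le; first by apply: integral_ge0 => t _; rewrite lee_fin sqr_ge0.
apply: le_integral_nonmeasurable => t; first by rewrite lee_fin sqr_ge0.
rewrite patchE; case: ifPn => [/set_mem/box_of_tuple tb|tb].
  by rewrite lee_fin ler_sqr ?nnegrE ?normc_ge0//; exact: fM.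
rewrite fout ?ComplexField.Normc.normc0 ?expr0n//.
by move=> /box_of_tuple H; move: tb; rewrite notin_setE.
Qed.

Lemma L2norm_ge f z0 (r M : R) : 0 <= r -> 0 <= M ->
  (forall z, box z0 r z -> M <= normc (f z)) ->
  ((M * Num.sqrt ((2 * r) ^+ N))%:E <= L2norm f)%E.
Proof.
move=> r0 M0 fM; rewrite L2normE -sqrt_volume// -(lebesgue_tuple_box (fun j => z0 0 j) r0).
rewrite -integral_cst_on; last exact: measurable_tuple_box.
have p0 t : (0 <= (cst (M ^+ 2)%:E \_ (tuple_box (fun j => z0 0%R j) r)) t)%E.
  by rewrite patchE; case: ifP => _ //; rewrite lee_fin sqr_ge0.
apply: poweR_half_le; first by apply: integral_ge0.
apply: le_integral_nonmeasurable => t //.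
rewrite patchE; case: ifPn => [/set_mem/box_of_tuple tb|tb]; rewrite lee_fin ?sqr_ge0//.
by rewrite ler_sqr ?nnegrE ?normc_ge0//; exact: fM.
Qed.

End L2_bounds.

(** * Uniform first-order expansions in a small parameter *)

Section asymptotics.
Variables (R : realType) (T : Type) (D : R -> T -> Prop).
Hypothesis D_eps : forall e y, D e y -> 0 < e <= 1.
Local Notation normc := ComplexField.Normc.normc.
Implicit Types (F G : R -> T -> R[i]) (A B : T -> R[i]).

Lemma normc_real (x : R) : normc x%:C = `|x|.
Proof. by rewrite /= expr0n addr0 sqrtr_sqr. Qed.

(** The parameter [e] will be 1/s and [y] the rescaled position; the bound is uniform in [y]. *)
Definition bigO (k : nat) F : Prop :=
  exists2 K : R, 0 <= K & forall e y, D e y -> normc (F e y) <= K * e ^+ k.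

Lemma bigO_ext k F G : (forall e y, D e y -> F e y = G e y) -> bigO k F -> bigO k G.
Proof. by move=> FG [K K0 HK]; exists K => // e y Dey; rewrite -FG//; exact: HK. Qed.

Lemma bigO_le k l F : (k <= l)%N -> bigO l F -> bigO k F.
Proof.
move=> kl [K K0 HK]; exists K => // e y Dey; apply: le_trans (HK _ _ Dey) _.
have /andP[e0 e1] := D_eps Dey.
by rewrite ler_wpM2l// ler_wiXn2l// ltW.
Qed.

Lemma bigOD k F G : bigO k F -> bigO k G -> bigO k (fun e y => F e y + G e y).
Proof.
move=> [K K0 HK] [L L0 HL]; exists (K + L); first exact: addr_ge0.
move=> e y Dey; apply: le_trans (le_normcD _ _) _.
by rewrite mulrDl lerD ?HK ?HL.
Qed.

Lemma bigOM k l F G : bigO k F -> bigO l G -> bigO (k + l) (fun e y => F e y * G e y).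
Proof.
move=> [K K0 HK] [L L0 HL]; exists (K * L); first exact: mulr_ge0.
move=> e y Dey; rewrite ComplexField.Normc.normcM exprD mulrACA.
by apply: ler_pM; rewrite ?normc_ge0 ?HK ?HL.
Qed.

Lemma bigO_cst (c : R[i]) : bigO 0 (fun _ _ => c).
Proof. by exists (normc c) => [|e y _]; rewrite ?normc_ge0// expr0 mulr1. Qed.

Lemma bigO_exp k : bigO k (fun e _ => (e ^+ k)%:C).
Proof.
exists 1 => // e y Dey; have /andP[e0 _] := D_eps Dey.
by rewrite normc_real ger0_norm ?mul1r// exprn_ge0// ltW.
Qed.

Lemma bigO0 k : bigO k (fun _ _ => 0).
Proof. by exists 0 => // e y _; rewrite ComplexField.Normc.normc0 mul0r. Qed.

Lemma bigO_sum k (I : Type) (r : seq I) (P : pred I) (F : I -> R -> T -> R[i]) :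
  (forall i, P i -> bigO k (F i)) -> bigO k (fun e y => \sum_(i <- r | P i) F i e y).
Proof.
move=> HF; elim: r => [|i r IH].
  by apply: bigO_ext (bigO0 k) => e y _; rewrite big_nil.
have [Pi|nPi] := boolP (P i).
  by apply: bigO_ext (bigOD (HF _ Pi) IH) => e y _; rewrite big_cons Pi.
by apply: bigO_ext IH => e y _; rewrite big_cons (negbTE nPi).
Qed.

(** F = A + e B + O(e^2). Boundedness of the coefficients is included because products of jets
    require it. *)
Definition jet F A B : Prop :=
  [/\ bigO 0 (fun _ => A), bigO 0 (fun _ => B) &
      bigO 2 (fun e y => F e y - (A y + e%:C * B y))].

Lemma jet_ext F F' A A' B B' :
  (forall e y, D e y -> F e y = F' e y) -> A =1 A' -> B =1 B' ->
  jet F A B -> jet F' A' B'.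
Proof.
move=> FF /funext<- /funext<- [a b f]; split=> //.
by apply: bigO_ext f => e y Dey; rewrite FF.
Qed.

Lemma jet_bigO0 F A B : jet F A B -> bigO 0 F.
Proof.
move=> [a b f].
apply: bigO_ext (bigOD (bigO_le (isT : 0 <= 2)%N f)
  (bigOD a (bigO_le (isT : 0 <= 1)%N (bigOM (bigO_exp 1) b)))) => e y _.
by rewrite expr1 subrK.
Qed.

Lemma jet_bigO2 F : jet F (fun _ => 0) (fun _ => 0) -> bigO 2 F.
Proof. by move=> [_ _]; apply: bigO_ext => e y _; rewrite mulr0 addr0 subr0. Qed.

Lemma jet_bigO1 F A B : jet F A B -> bigO 1 (fun e y => F e y - A y).
Proof.
move=> [a b f].
apply: bigO_ext (bigOD (bigO_le (isT : 1 <= 2)%N f) (bigOM (bigO_exp 1) b)) => e y _.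
by rewrite expr1; ring.
Qed.

Lemma jet_cst (c : R[i]) : jet (fun _ _ => c) (fun _ => c) (fun _ => 0).
Proof.
split; [exact: bigO_cst|exact: bigO_cst|].
by apply: bigO_ext (bigO0 2) => e y _; rewrite mulr0 addr0 subrr.
Qed.

Lemma jetD F G A A' B B' : jet F A B -> jet G A' B' ->
  jet (fun e y => F e y + G e y) (fun y => A y + A' y) (fun y => B y + B' y).
Proof.
move=> [a b f] [a' b' g]; split; [exact: bigOD|exact: bigOD|].
by apply: bigO_ext (bigOD f g) => e y _; ring.
Qed.

Lemma jetM F G A A' B B' : jet F A B -> jet G A' B' ->
  jet (fun e y => F e y * G e y) (fun y => A y * A' y)
    (fun y => B y * A' y + A y * B' y).
Proof.
move=> JF JG; have [a b f] := JF; have [a' b' g] := JG; split.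
- exact: bigOM a a'.
- exact: bigOD (bigOM b a') (bigOM a b').
(* The remainder of the product is (F - A - eB) G + A (G - A' - eB') + e B (G - A'). *)
apply: bigO_ext (bigOD (bigOD (bigOM f (jet_bigO0 JG)) (bigOM a g))
  (bigOM (bigOM (bigO_exp 1) b) (jet_bigO1 JG))) => e y _.
by rewrite expr1; ring.
Qed.

Lemma jetZ (c : R[i]) F A B : jet F A B ->
  jet (fun e y => c * F e y) (fun y => c * A y) (fun y => c * B y).
Proof.
move=> JF; apply: jet_ext (jetM (jet_cst c) JF) => // y.
by rewrite mul0r add0r.
Qed.

Lemma jet_eps F A B : jet F A B ->
  jet (fun e y => e%:C * F e y) (fun _ => 0) A.
Proof.
move=> JF; have [a _ _] := JF; split; [exact: bigO_cst|exact: a|].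
by apply: bigO_ext (bigOM (bigO_exp 1) (jet_bigO1 JF)) => e y _; rewrite expr1; ring.
Qed.

Lemma jet_sum (I : Type) (r : seq I) (P : pred I) (F : I -> R -> T -> R[i])
    (A B : I -> T -> R[i]) :
  (forall i, P i -> jet (F i) (A i) (B i)) ->
  jet (fun e y => \sum_(i <- r | P i) F i e y) (fun y => \sum_(i <- r | P i) A i y)
    (fun y => \sum_(i <- r | P i) B i y).
Proof.
move=> HF; elim: r => [|i r IH].
  apply: jet_ext (jet_cst 0) => [e y _|y|y]; by rewrite big_nil.
have [Pi|nPi] := boolP (P i).
  by apply: jet_ext (jetD (HF _ Pi) IH) => [e y _|y|y]; rewrite big_cons Pi.
by apply: jet_ext IH => [e y _|y|y]; rewrite big_cons (negbTE nPi).
Qed.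

Lemma jet_prod (I : finType) (F : I -> R -> T -> R[i]) (A B : I -> T -> R[i]) :
  (forall i, jet (F i) (A i) (B i)) ->
  jet (fun e y => \prod_i F i e y) (fun y => \prod_i A i y)
    (fun y => \sum_i B i y * \prod_(k | k != i) A k y).
Proof.
(* The enumeration must be duplicate-free: at a repeated index the condition [k != i] would delete
   several factors. *)
move=> HF; elim: (index_enum _) (index_enum_uniq I) => [_|i r IH /= /andP[ir ur]].
  by apply: jet_ext (jet_cst 1) => [e y _|y|y]; rewrite big_nil.
apply: jet_ext (jetM (HF i) (IH ur)) => [e y _|y|y]; rewrite ?big_cons//.
rewrite eqxx; congr (_ * _ + _).
  rewrite big_seq [RHS]big_seq_cond; apply: eq_bigl => k.
  by case kr: (k \in r) => //=; apply/esym; apply: contraNneq ir => <-.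
rewrite mulr_sumr big_seq [RHS]big_seq; apply: eq_bigr => k kr.
have ik : i != k by apply: contraNneq ir => ->.
by rewrite big_cons ik mulrCA.
Qed.

End asymptotics.

(** * One-variable wave packets *)

Section wave_packet.
Variables (R : realType).
Local Notation normc := ComplexField.Normc.normc.

(* [packet theta e n c y] is [(theta - i e d/dy)^n] applied to the [c]-th
   derivative of the bump, at [y]. *)
Fixpoint packet (theta : R[i]) (e : R) (n c : nat) (y : R) : R[i] :=
  if n is n'.+1 then
    theta * packet theta e n' c y - 'i * e%:C * packet theta e n' c.+1 y
  else (bump c y)%:C.

Lemma packet_out theta e n c y : 1 <= `|y| -> packet theta e n c y = 0.
Proof.
move=> y1; elim: n c => [|n IH] c /=; first by rewrite bump_out.
by rewrite !IH !mulr0 subr0.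
Qed.

(** d/dy commutes with theta - i e d/dy, so it only raises [c]. *)
Lemma is_cderive_packet theta e n c y :
  is_cderive y (packet theta e n c) (packet theta e n c.+1 y).
Proof.
elim: n c => [|n IH] c /=; first exact: is_cderive_real (is_derive_bump c y).
rewrite -mulNr; under [X in is_cderive _ X _]eq_fun do rewrite -mulNr.
exact: is_cderiveD (is_cderiveZ _ (IH c)) (is_cderiveZ _ (IH c.+1)).
Qed.

(** Closed form of the n-th derivative of exp(i s^2 theta (t - t0)) bump(s (t - t0)): conjugated by
    the exponential and written in y = s (t - t0), d/dt becomes i s^2 (theta - i s^-1 d/dy). *)
Definition wave (theta : R[i]) (s t0 : R) (n : nat) (t : R) : R[i] :=
  ('i * (s ^+ 2)%:C) ^+ n *
    (cexp ('i * (s ^+ 2)%:C * theta * (t - t0)%:C) *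
      packet theta s^-1 n 0 (s * (t - t0))).

Lemma is_cderive_wave theta (s t0 : R) n t : s != 0 ->
  is_cderive t (wave theta s t0 n) (wave theta s t0 n.+1 t).
Proof.
move=> s0; rewrite /wave.
have dE := is_cderive_cexp ('i * (s ^+ 2)%:C * theta) (1 * (t - t0)).
have {dE} := is_cderive_affine dE; rewrite mul1r.
under [X in is_cderive _ X _]eq_fun do rewrite mul1r.
move=> dE; have dV := is_cderive_affine (is_cderive_packet theta s^-1 n 0 (s * (t - t0))).
have := is_cderiveZ (('i * (s ^+ 2)%:C) ^+ n) (is_cderiveM dE dV).
congr is_cderive.
(* Rewrites the chain-rule factor [s] of the bump as the prefactor s^2 times the small parameter
   s^-1. *)
have sE : s%:C = (s ^+ 2)%:C * (s^-1)%:C.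
  by rewrite -rmorphM /=; congr (_%:C); field.
have i2 : 'i * 'i = -1 :> R[i] by rewrite -expr2 sqr_i.
rewrite [packet _ _ n.+1 _ _]/=.
set E := cexp _; set P := packet _ _ n 0 _; set P1 := packet _ _ n 1 _.
rewrite sE; set q := (s ^+ 2)%:C; set e := (s^-1)%:C.
rewrite [_ ^+ n.+1]exprS (_ : 1%:C = 1)//.
have -> : 'i * q * ('i * q) ^+ n * (E * (theta * P - 'i * e * P1)) =
   ('i * q) ^+ n * (('i * q * theta * E) * P - ('i * 'i) * q * e * E * P1) by ring.
by rewrite i2; ring.
Qed.

(** The first two terms of the binomial expansion of (theta - i e d/dy)^n; the bumps are bounded, so
    the coefficients are. *)
Lemma jet_packet (T : Type) (D : R -> T -> Prop)
    (D_eps : forall e y, D e y -> 0 < e <= 1) theta n c (x : T -> R) :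
  jet D (fun e y => packet theta e n c (x y))
    (fun y => theta ^+ n * (bump c (x y))%:C)
    (fun y => n%:R * theta ^+ n.-1 * (- 'i * (bump c.+1 (x y))%:C)).
Proof.
elim: n c => [|n IH] c.
  have [K HK] := bump_bounded R c.
  split.
  - exists `|K| => // e y _; rewrite expr0 !mul1r mulr1 normc_real.
    by apply: le_trans (HK _) _; rewrite ler_norm.
  - by apply: bigO_ext (bigO0 D 0) => e y _; rewrite !mul0r.
  - by apply: bigO_ext (bigO0 D 2) => e y _ /=; rewrite !mul0r mulr0 addr0 mul1r subrr.
apply: jet_ext (jetD (jetZ D_eps theta (IH c)) (jetZ D_eps (- 'i) (jet_eps D_eps (IH c.+1)))).
- by move=> e y _ /=; ring.
- by move=> y; rewrite mulr0 addr0 exprS mulrA.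
(* At [n = 0] the exponent [n.-1] is truncated, harmlessly, since its coefficient [n%:R] is zero. *)
- move=> y; case: n {IH} => [|n] /=; first by rewrite !mul0r mulr0 add0r !expr0 !mul1r.
  by rewrite exprS [in RHS]mulrSr; ring.
Qed.

End wave_packet.

(** * The differential of the principal symbol *)

Section symbol_derivatives.

(* The coefficient of [t] in [(theta + t e_j)^b]. *)
Definition dmonomial (K : fieldType) (N : nat) (theta : 'rV[K]_N) (j : 'I_N)
    (b : 'I_N -> nat) : K :=
  (b j)%:R * theta 0 j ^+ (b j).-1 * \prod_(k | k != j) theta 0 k ^+ b k.

Lemma is_derive_monomials (K : numFieldType) (N : nat) (theta : 'rV[K]_N) (j : 'I_N)
    (n : nat) (c : 'I_n -> K) (b : 'I_n -> 'I_N -> nat) :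
  is_derive theta 'e_j (fun zeta => \sum_i c i * \prod_k zeta 0 k ^+ b i k)
    (\sum_i c i * dmonomial theta j (b i)).
Proof.
pose g := \sum_(i < n) ((c i * \prod_(k | k != j) theta 0 k ^+ b i k) *: (fun t : K => t ^+ b i j)).
apply: (iffLR (@is_derive_lineP K N _ g j theta (theta 0 j) _ _)).
  move=> h; rewrite /g fct_sumE; apply: eq_bigr => i _.
  transitivity (c i * (\prod_(k | k != j) theta 0 k ^+ b i k) * (h + theta 0 j) ^+ b i j) => //.
  rewrite (bigD1 j)//= !mxE !eqxx mulr1 -mulrA; congr (_ * _); rewrite mulrC; congr (_ * _).
  by apply: eq_bigr => k kj; rewrite !mxE /= (negbTE kj) mulr0 add0r.
have dX m : is_derive (theta 0 j) (1 : K) (fun t : K => t ^+ m) (m%:R * theta 0 j ^+ m.-1).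
  have := is_deriveX m (is_derive_id (theta 0 j) (1 : K)).
  rewrite exprfctE [_ *: _]mulr1 => H; apply: (is_derive_eq H).
  by case: m {H} => [|m]; rewrite ?mul0r ?mulr0n//= mulr_natl.
have := is_derive_sum (fun i : 'I_n => is_deriveZ (c i * \prod_(k | k != j) theta 0 k ^+ b i k) (dX (b i j))).
move=> H; apply: (is_derive_eq H); apply: eq_bigr => i _.
rewrite /dmonomial; set p := \prod_(k < N | _) _.
transitivity (c i * p * ((b i j)%:R * theta 0 j ^+ (b i j).-1)) => //; ring.
Qed.

Variables (R : realType) (N : nat).
Local Notation Re := complex.Re.
Local Notation Im := complex.Im.

Definition is_cpartial (j : 'I_N) (z : 'rV[R]_N) (f : 'rV[R]_N -> R[i]) (l : R[i]) :=
  is_derive z 'e_j (fun x => Re (f x)) (Re l) /\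
  is_derive z 'e_j (fun x => Im (f x)) (Im l).

Lemma is_cpartial_val j z f l : is_cpartial j z f l -> cpartial j f z = l.
Proof.
move=> [fr fi]; rewrite /cpartial /partial.
rewrite (@derive_val _ _ _ _ _ _ _ fr) (@derive_val _ _ _ _ _ _ _ fi).
by case: l {fr fi}.
Qed.

Lemma csmooth_is_cpartial (Z : set 'rV[R]_N) j z f : csmooth_on Z f -> Z z ->
  is_cpartial j z f (cpartial j f z).
Proof.
move=> [fr fi] Zz; have [_ /(_ j)/derivableP dr] := fr [::] _ Zz.
by have [_ /(_ j)/derivableP di] := fi [::] _ Zz.
Qed.

Lemma is_cpartial_sum j z (I : Type) (r : seq I) (P : pred I)
    (f : I -> 'rV[R]_N -> R[i]) (l c : I -> R[i]) :
  (forall i, P i -> is_cpartial j z (f i) (l i)) ->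
  is_cpartial j z (fun x => \sum_(i <- r | P i) f i x * c i) (\sum_(i <- r | P i) l i * c i).
Proof.
move=> Hf; elim: r => [|i r IH].
  by split; under eq_fun do rewrite big_nil; rewrite big_nil; apply: is_derive_cst.
have [Pi|nPi] := boolP (P i); last first.
  by split; under eq_fun do rewrite big_cons (negbTE nPi);
    rewrite big_cons (negbTE nPi); apply IH.
have [fr fi] := Hf _ Pi; have [gr gi] := IH.
split; under eq_fun do rewrite big_cons Pi; rewrite big_cons Pi.
- apply: is_derive_ext (is_deriveD (is_deriveB (is_deriveZ (Re (c i)) fr)
    (is_deriveZ (Im (c i)) fi)) gr) => [x|].
    rewrite ReD ReM; set y := Re (\sum_(_ <- r | _) _).
    by transitivity (Re (c i) * Re (f i x) - Im (c i) * Im (f i x) + y) => //; ring.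
  by rewrite !regular_scaleE ReD ReM; ring.
- apply: is_derive_ext (is_deriveD (is_deriveD (is_deriveZ (Im (c i)) fr)
    (is_deriveZ (Re (c i)) fi)) gi) => [x|].
    rewrite ImD ImM; set y := Im (\sum_(_ <- r | _) _).
    by transitivity (Im (c i) * Re (f i x) + Re (c i) * Im (f i x) + y) => //; ring.
  by rewrite !regular_scaleE ImD ImM; ring.
Qed.

Variables (m : nat) (Z : set 'rV[R]_N) (a : multi_index N -> 'rV[R]_N -> R[i]).
Hypothesis a_smooth : forall b, (mi_deg b <= m)%N -> csmooth_on Z (a b).
Variables (z0 : 'rV[R]_N) (z0_in : Z z0) (theta : 'rV[R[i]]_N).

Lemma cpartial_symbol j : cpartial j (principal_symbol m a ^~ theta) z0 =
  \sum_(b : {ffun 'I_N -> 'I_m.+1} | mi_deg (fun j => b j) == m)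
    cpartial j (a (fun j => b j)) z0 * mi_pow theta (fun j => b j).
Proof.
apply: is_cpartial_val; apply: is_cpartial_sum => b /eqP bm.
by apply: csmooth_is_cpartial z0_in; apply: a_smooth; rewrite bm.
Qed.

Lemma hpartial_symbol j : hpartial j (principal_symbol m a z0) theta =
  \sum_(b : {ffun 'I_N -> 'I_m.+1} | mi_deg (fun j => b j) == m)
    a (fun j => b j) z0 * dmonomial theta j (fun j => b j).
Proof.
(* Enumerating the multi-indices of degree m turns the symbol into a sum over ordinals, the form of
   [is_derive_monomials]. *)
pose A := enum [pred b : {ffun 'I_N -> 'I_m.+1} | mi_deg (fun j => b j) == m].
pose B (i : 'I_(size A)) := tnth (in_tuple A) i.
have sumE (F : {ffun 'I_N -> 'I_m.+1} -> R[i]) :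
    \sum_(b : {ffun 'I_N -> 'I_m.+1} | mi_deg (fun j => b j) == m) F b = \sum_i F (B i).
  by rewrite -big_enum big_tnth.
have H := @is_derive_monomials R[i] N theta j _ (fun i => a (fun j => B i j) z0)
  (fun i j => B i j).
rewrite sumE; apply: etrans (@derive_val _ _ _ _ _ _ _ H); rewrite /hpartial.
have -> : principal_symbol m a z0 =
    fun zeta => \sum_i a (fun j => B i j) z0 * \prod_k zeta 0 k ^+ B i k.
  by apply/funext => zeta; rewrite /principal_symbol sumE.
by [].
Qed.

End symbol_derivatives.

(** * Expansion of the rescaled operator at the characteristic point *)

Section concentrated_expansions.
Variables (R : realType) (N : nat).
Local Notation normc := ComplexField.Normc.normc.
Implicit Types (y z : 'rV[R]_N) (r e : R).

(** [e <= 1] makes powers of [e] comparable, [e <= r] keeps z0 + e y where Taylor's estimate holds,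
    and the unit box contains the support of the profile. *)
Definition scaled_domain r e y : Prop := 0 < e <= Num.min 1 r /\ box 0 1 y.

Lemma scaled_domain_eps r e y : scaled_domain r e y -> 0 < e <= 1.
Proof. by move=> [/andP[->]]; rewrite le_min => /andP[-> _]. Qed.

Lemma box_scaled r e y z0 : scaled_domain r e y -> box z0 e (z0 + e *: y).
Proof.
move=> [/andP[e0 _] y1] j; rewrite !mxE addrAC subrr add0r normrM gtr0_norm//.
by apply: ler_piMr; [exact: ltW|have := y1 j; rewrite mxE subr0].
Qed.

Lemma normc_le_ReIm (x : R[i]) : normc x <= `|complex.Re x| + `|complex.Im x|.
Proof.
case: x => a b /=; rewrite -[leRHS]ger0_norm ?addr_ge0// -sqrtr_sqr ler_wsqrtr//.
rewrite sqrrD !real_normK ?num_real// addrAC lerDl.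
by rewrite mulrn_wge0// mulr_ge0.
Qed.

Lemma bigO_coord r j : bigO (scaled_domain r) 0 (fun _ y => (y 0 j)%:C).
Proof.
exists 1 => // e y [_ /(_ j)]; rewrite mxE subr0 => y1.
by rewrite normc_real expr0 mulr1.
Qed.

(** Stated for all small [r], so that the finitely many coefficients of the operator can share one
    [r]. *)
Lemma jet_smooth (Z : set 'rV[R]_N) (f : 'rV[R]_N -> R[i]) z0 :
  open Z -> Z z0 -> csmooth_on Z f ->
  \forall r \near 0^'+, jet (scaled_domain r) (fun e y => f (z0 + e *: y))
    (fun _ => f z0) (fun y => \sum_j cpartial j f z0 * (y 0 j)%:C).
Proof.
move=> oZ Zz0 [fr fi].
have [r1 [K1 [r10 K10 _ H1]]] := smooth_taylor oZ Zz0 fr.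
have [r2 [K2 [r20 K20 _ H2]]] := smooth_taylor oZ Zz0 fi.
have r120 : 0 < Num.min r1 r2 by rewrite lt_min r10.
near=> r.
have rr : r <= Num.min r1 r2 by near: r; exact: nbhs_right_le.
split.
- by apply: bigO_ext (bigO_cst _ (f z0)).
- apply: bigO_sum => j _.
  exact: (bigOM (bigO_cst _ (cpartial j f z0)) (bigO_coord r j)).
exists (K1 + K2); first exact: addr_ge0.
move=> e y Dey; have [/andP[e0 er] y1] := Dey.
apply: le_trans (normc_le_ReIm _) _; rewrite mulrDl.
have ye := box_scaled z0 Dey.
have {}er : 0 <= e <= Num.min r1 r2.
  by rewrite ltW//=; apply: le_trans rr; move: er; rewrite le_min => /andP[].
have e1 : 0 <= e <= r1 by move: er; rewrite le_min => /and3P[-> ->].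
have e2 : 0 <= e <= r2 by move: er; rewrite le_min => /and3P[-> _ ->].
have zE j : (z0 + e *: y) 0 j - z0 0 j = e * y 0 j by rewrite !mxE addrAC subrr add0r.
set w := f (z0 + e *: y) - _.
have wE : w = f (z0 + e *: y) - f z0 - \sum_j cpartial j f z0 * (e * y 0 j)%:C.
  rewrite /w opprD addrA mulr_sumr; congr (_ - _); apply: eq_bigr => j _.
  by rewrite rmorphM /=; ring.
have ReS (r0 : seq 'I_N) (F : 'I_N -> R[i]) :
    complex.Re (\sum_(j <- r0) F j) = \sum_(j <- r0) complex.Re (F j).
  by elim: r0 => [|j r0 IH]; rewrite ?big_nil// !big_cons ReD IH.
have ImS (r0 : seq 'I_N) (F : 'I_N -> R[i]) :
    complex.Im (\sum_(j <- r0) F j) = \sum_(j <- r0) complex.Im (F j).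
  by elim: r0 => [|j r0 IH]; rewrite ?big_nil// !big_cons ImD IH.
have ReN (x : R[i]) : complex.Re (- x) = - complex.Re x by case: x.
have ImN (x : R[i]) : complex.Im (- x) = - complex.Im x by case: x.
apply: lerD.
- have := H1 _ _ e1 ye; congr (`| _ | <= _).
  rewrite wE !ReD !ReN ReS; congr (_ - _); apply: eq_bigr => j _.
  by rewrite zE ReM /= mulr0 subr0.
- have := H2 _ _ e2 ye; congr (`| _ | <= _).
  rewrite wE !ImD !ImN ImS; congr (_ - _); apply: eq_bigr => j _.
  by rewrite zE ImM /= mulr0 add0r.
Unshelve. all: by end_near. Qed.

Variable theta : 'rV[R[i]]_N.

(** (theta + e D_y)^b applied to the product bump. *)
Definition packet_prod (b : 'I_N -> nat) e y : R[i] :=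
  \prod_j packet (theta 0 j) e (b j) 0 (y 0 j).

Lemma packet_prod_out b e y : ~ box 0 1 y -> packet_prod b e y = 0.
Proof.
move=> /existsNP[j]; rewrite mxE subr0 => /negP; rewrite -ltNge => yj.
by rewrite /packet_prod (bigD1 j)//= packet_out ?mul0r// ltW.
Qed.

Definition bump_prod y : R[i] := \prod_j (bump 0 (y 0 j))%:C.

Definition dbump_prod j y : R[i] :=
  - 'i * (bump 1 (y 0 j))%:C * \prod_(k | k != j) (bump 0 (y 0 k))%:C.

(** (theta + e D_y)^b = theta^b + e sum_j (d_j theta^b) D_j + O(e^2), where [dbump_prod j] is D_j of
    [bump_prod]. *)
Lemma jet_packet_prod r b : jet (scaled_domain r) (packet_prod b)
  (fun y => mi_pow theta b * bump_prod y)
  (fun y => \sum_j dmonomial theta j b * dbump_prod j y).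
Proof.
have J j := jet_packet (@scaled_domain_eps r) (theta 0 j) (b j) 0 (fun y => y 0 j).
apply: jet_ext (jet_prod (@scaled_domain_eps r) J) => [//|y|y].
  by rewrite big_split.
apply: eq_bigr => j _; rewrite big_split /= /dmonomial /dbump_prod; ring.
Qed.

Variables (m : nat) (Z : set 'rV[R]_N) (a : multi_index N -> 'rV[R]_N -> R[i]).
Hypotheses (Z_open : open Z)
  (a_smooth : forall b, (mi_deg b <= m)%N -> csmooth_on Z (a b)).
Variable z0 : 'rV[R]_N.
Hypotheses (z0_in : Z z0) (char0 : principal_symbol m a z0 theta = 0)
  (dchar0 : diff_symbol (principal_symbol m a) z0 theta = 0).

(** s^(-2m) Q conjugated by the exponential, with e = 1/s: a derivative of order |b| brings
    s^(2|b|), leaving e^(2(m-|b|)). *)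
Definition scaled_operator e y : R[i] :=
  \sum_(b : {ffun 'I_N -> 'I_m.+1} | (mi_deg (fun j => b j) <= m)%N)
    a (fun j => b j) (z0 + e *: y) *
    ((e ^+ (2 * (m - mi_deg (fun j => b j))))%:C * packet_prod (fun j => b j) e y).

(** With chi the product bump, the constant term is q chi and the coefficient of e is the sum over j
    of (dq/dz_j) y_j chi + (dq/dzeta_j) D_j chi, all taken at (z0, theta). Both are zero by
    hypothesis. *)
Lemma scaled_operator_bigO2 :
  \forall r \near 0^'+, bigO (scaled_domain r) 2 scaled_operator.
Proof.
have Ja : \forall r \near 0^'+, forall b : {ffun 'I_N -> 'I_m.+1},
    (mi_deg (fun j => b j) <= m)%N ->
    jet (scaled_domain r) (fun e y => a (fun j => b j) (z0 + e *: y))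
      (fun _ => a (fun j => b j) z0)
      (fun y => \sum_j cpartial j (a (fun j => b j)) z0 * (y 0 j)%:C).
  apply: (@filter_forall _ _ (fun (b : {ffun 'I_N -> 'I_m.+1}) r =>
    (mi_deg (fun j => b j) <= m)%N ->
    jet (scaled_domain r) (fun e y => a (fun j => b j) (z0 + e *: y))
      (fun _ => a (fun j => b j) z0)
      (fun y => \sum_j cpartial j (a (fun j => b j)) z0 * (y 0 j)%:C)) (0^'+)) => b.
  case: (leqP (mi_deg (fun j => b j)) m) => bm; last by near=> r.
  by apply: filterS (jet_smooth Z_open z0_in (a_smooth bm)).
apply: filterS Ja => r Ja; have De := @scaled_domain_eps r.
pose lead (b : {ffun 'I_N -> 'I_m.+1}) := mi_deg (fun j => b j) == m.
pose F (b : {ffun 'I_N -> 'I_m.+1}) e y := a (fun j => b j) (z0 + e *: y) *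
    ((e ^+ (2 * (m - mi_deg (fun j => b j))))%:C * packet_prod (fun j => b j) e y).
(* Below the top degree, m - |b| >= 1 already provides the factor e^2. *)
have Olow : bigO (scaled_domain r) 2 (fun e y =>
    \sum_(b : {ffun 'I_N -> 'I_m.+1} | (mi_deg (fun j => b j) <= m)%N && ~~ lead b) F b e y).
  apply: bigO_sum => b /andP[bm bl].
  have O1 := bigOM (bigO_exp De (2 * (m - mi_deg (fun j => b j))))
    (jet_bigO0 De (jet_packet_prod r (fun j => b j))).
  apply: (bigO_le De _ (bigOM (jet_bigO0 De (Ja _ bm)) O1)).
  by rewrite add0n addn0 leq_pmulr// subn_gt0 ltn_neqAle bm andbT.
have Olead : bigO (scaled_domain r) 2 (fun e y => \sum_(b : {ffun 'I_N -> 'I_m.+1} | lead b)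
    a (fun j => b j) (z0 + e *: y) * packet_prod (fun j => b j) e y).
  have Jb (b : {ffun 'I_N -> 'I_m.+1}) (lb : lead b) :=
    jetM De (Ja b (eq_leq (eqP lb))) (jet_packet_prod r (fun j => b j)).
  apply: jet_bigO2; apply: jet_ext (jet_sum (index_enum _) Jb) => [//|y|y].
    under eq_bigr do rewrite mulrA.
    by rewrite -mulr_suml [X in X * _]char0 mul0r.
  rewrite big_split /=.
  under eq_bigr do rewrite mulr_suml.
  rewrite exchange_big /= [X in X + _]big1 ?add0r => [|j _]; last first.
    transitivity ((y 0 j)%:C * bump_prod y * cpartial j (principal_symbol m a ^~ theta) z0).
      rewrite (cpartial_symbol a_smooth z0_in) mulr_sumr.
      by apply: eq_bigr => b _; ring.
    have /rowP/(_ (lshift N j)) := dchar0.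
    by rewrite /diff_symbol row_mxEl !mxE => ->; rewrite mulr0.
  under eq_bigr do rewrite mulr_sumr.
  rewrite exchange_big /= big1 // => j _.
  transitivity (dbump_prod j y * hpartial j (principal_symbol m a z0) theta).
    by rewrite hpartial_symbol mulr_sumr; apply: eq_bigr => b _; ring.
  have /rowP/(_ (rshift N j)) := dchar0.
  by rewrite /diff_symbol row_mxEr !mxE => ->; rewrite mulr0.
apply: bigO_ext (bigOD Olead Olow) => e y _.
rewrite /scaled_operator [RHS](bigID lead) /=; congr (_ + _).
rewrite [RHS](eq_bigl lead) => [|b]; last first.
  by rewrite /lead; case: eqVneq => [->|_]; rewrite ?leqnn ?andbF.
by apply: eq_bigr => b /eqP ->; rewrite subnn muln0 expr0 mul1r.
Unshelve. all: by end_near. Qed.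

End concentrated_expansions.

(** * The wave packet: derivatives, support and weighted size *)

Section wave_packet_norms.
Variables (R : realType) (N : nat).
Local Notation normc := ComplexField.Normc.normc.
Variables (theta : 'rV[R[i]]_N) (z0 : 'rV[R]_N) (s : R) (s_gt0 : 0 < s).

Definition wave_packet (z : 'rV[R]_N) : R[i] :=
  tensor (fun j n t => wave (theta 0 j) s (z0 0 j) n t) (fun _ => 0) z.

Definition phase (z : 'rV[R]_N) : R[i] :=
  \prod_j cexp ('i * (s ^+ 2)%:C * theta 0 j * (z 0 j - z0 0 j)%:C).

Lemma wave_packet_derive j n t :
  is_cderive t (wave (theta 0 j) s (z0 0 j) n) (wave (theta 0 j) s (z0 0 j) n.+1 t).
Proof. by apply: is_cderive_wave; rewrite gt_eqF. Qed.

Lemma csmooth_wave_packet : csmooth_on setT wave_packet.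
Proof. exact: (csmooth_tensor wave_packet_derive). Qed.

Lemma mi_D_wave_packet b z : mi_D b wave_packet z =
  (s ^+ (2 * mi_deg b))%:C * (phase z * packet_prod theta b s^-1 (s *: (z - z0))).
Proof.
rewrite /wave_packet (_ : (fun z => _) = tensor (fun j n t => wave (theta 0 j) s (z0 0 j) n t) (fun _ => 0))//.
rewrite (mi_D_tensor wave_packet_derive) /tensor /phase /packet_prod -big_split /=.
rewrite {1}/mi_deg -prodrXr -big_split /=.
have -> : (s ^+ (2 * mi_deg b))%:C = \prod_(j < N) ((s ^+ 2)%:C ^+ b j).
  by rewrite prodrXr -/(mi_deg b) exprM rmorphXn.
rewrite -big_split /=; apply: eq_bigr => j _.
rewrite /wave !mxE; set E := cexp _; set P := packet _ _ _ _ _; set q := (s ^+ 2)%:C.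
have i1 : (- 'i) ^+ b j * 'i ^+ b j = 1 :> R[i].
  by rewrite -exprMn mulNr -expr2 sqr_i opprK expr1n.
transitivity ((- 'i) ^+ b j * 'i ^+ b j * (q ^+ b j * (E * P))).
  by rewrite exprMn; ring.
by rewrite i1 mul1r.
Qed.

Lemma diffop_wave_packet m (a : multi_index N -> 'rV[R]_N -> R[i]) z :
  diffop m a wave_packet z = (s ^+ (2 * m))%:C *
    (phase z * scaled_operator theta m a z0 s^-1 (s *: (z - z0))).
Proof.
have s0 : s != 0 by rewrite gt_eqF.
rewrite /diffop /scaled_operator !mulr_sumr; apply: eq_bigr => b bm.
rewrite mi_D_wave_packet scalerA mulVf// scale1r [z0 + _]addrC subrK.
set k := mi_deg _ in bm *.
have -> : (s ^+ (2 * k))%:C = (s ^+ (2 * m))%:C * (s^-1 ^+ (2 * (m - k)))%:C.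
  rewrite -rmorphM /=; congr (_%:C); rewrite exprVn -[in s ^+ (2 * m)](subnK bm) mulnDr exprD.
  by rewrite mulrAC mulfV ?mul1r// expf_neq0.
ring.
Qed.

Lemma box_rescale (rho : R) z : box z0 (s^-1 * rho) z <-> box 0 rho (s *: (z - z0)).
Proof.
have E j : (`|z 0 j - z0 0 j| <= s^-1 * rho) = (`|(s *: (z - z0)) 0 j - (0 : 'rV[R]_N) 0 j| <= rho).
  by rewrite !mxE subr0 normrM gtr0_norm// ler_pdivlMl.
by split=> H j; have := H j; rewrite E.
Qed.

Lemma normc_phase z :
  normc (phase z) = expR (- (s ^+ 2 * \sum_j complex.Im (theta 0 j) * (z 0 j - z0 0 j))).
Proof.
rewrite /phase (big_morph (@ComplexField.Normc.normc R) (@ComplexField.Normc.normcM R) (@ComplexField.Normc.normc1 R)).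
rewrite mulr_sumr -sumrN expR_sum; apply: eq_bigr => j _; rewrite normc_cexp; congr expR.
by rewrite !ReM !ImM /=; ring.
Qed.

Lemma normc_weighted tau (phi : 'rV[R]_N -> R) (f : 'rV[R]_N -> R[i]) z :
  normc (weighted tau phi f z) = expR (tau * phi z) * normc (f z).
Proof.
by rewrite /weighted ComplexField.Normc.normcM normc_real ger0_norm ?expR_ge0.
Qed.

(** The strict inequality leaves a margin r - s^-1 within which a point of the closure is compared
    with a point where the packet is nonzero. *)
Lemma csupp_wave_packet (Z : set 'rV[R]_N) (r : R) :
  box z0 r `<=` Z -> s^-1 < r -> csupp wave_packet `<=` Z.
Proof.
move=> rZ sr z cz; apply: rZ => j.
have r0 : 0 < r - s^-1 by rewrite subr_gt0.
have /cz[x [/= ux]] : nbhs z (ball z (r - s^-1)) by exact: nbhsx_ballx.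
move=> [_ /(_ 0 j)]; rewrite /ball /= => zx.
have xe : `|x 0 j - z0 0 j| <= s^-1.
  suff : box z0 (s^-1 * 1) x by move=> /(_ j); rewrite mulr1.
  apply/box_rescale; apply: contrapT => nb; move/eqP: ux; apply.
  (* Vanishing outside the box is read off the formula for D^b at b = 0. *)
  have := mi_D_wave_packet (fun _ => 0) x.
  rewrite packet_prod_out// !mulr0 => mi0.
  have mdE : mi_D (fun _ => 0) wave_packet x = wave_packet x.
    rewrite /mi_D /mi_deg big1// expr0 mul1r.
    by elim: (enum 'I_N) => //= i l ->.
  by rewrite -mdE.
rewrite (_ : z 0 j - z0 0 j = (z 0 j - x 0 j) + (x 0 j - z0 0 j)); last by ring.
by apply: le_trans (ler_normD _ _) _; rewrite -[leRHS](subrK s^-1) lerD// ltW.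
Qed.

Variables (phi : 'rV[R]_N -> R) (tau0 K r : R) (tau0_gt0 : 0 < tau0).
Hypotheses (theta_Im : forall j, complex.Im (theta 0 j) = tau0 * partial j phi z0)
  (r_ge : s^-1 <= r)
  (phi_taylor : forall z e, 0 <= e <= r -> box z0 e z ->
    `|phi z - phi z0 - \sum_j partial j phi z0 * (z 0 j - z0 0 j)| <= K * e ^+ 2).

(* On the support of the packet the weight cancels the growth of the phase up
   to a factor independent of [s], because [tau (s^-1)^2 = tau0]. *)
Lemma weight_phase z : box z0 s^-1 z ->
  expR (tau0 * s ^+ 2 * phi z0 - tau0 * K) <=
    expR (tau0 * s ^+ 2 * phi z) * normc (phase z) <=
  expR (tau0 * s ^+ 2 * phi z0 + tau0 * K).
Proof.
move=> zb; rewrite normc_phase -expRD !ler_expR.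
have se : 0 <= s^-1 <= r by rewrite invr_ge0 ltW.
have := phi_taylor se zb.
set S := \sum_j partial j phi z0 * _.
(* Im theta is tau0 dphi(z0), so the decay of the phase cancels the linear part of the weight; only
   the Taylor remainder survives. *)
have -> : \sum_j complex.Im (theta 0 j) * (z 0 j - z0 0 j) = tau0 * S.
  by rewrite mulr_sumr; apply: eq_bigr => j _; rewrite theta_Im mulrA.
move=> /(ler_wpM2l (ltW (mulr_gt0 tau0_gt0 (exprn_gt0 2 s_gt0)))).
have -> : tau0 * s ^+ 2 * (K * s^-1 ^+ 2) = tau0 * K.
  by field; rewrite gt_eqF.
have q0 : 0 <= tau0 * s ^+ 2 by rewrite ltW// mulr_gt0// exprn_gt0.
rewrite -{1}(ger0_norm q0) -normrM ler_norml => /andP[lo hi]; apply/andP; split; lra.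
Qed.

End wave_packet_norms.

(** * From the weighted estimate to a bound on tau^delta *)

Lemma bounded_powR_eq0 (R : realType) (delta C T : R) : 0 <= delta ->
  (forall tau, T <= tau -> tau `^ delta <= C) -> delta = 0.
Proof.
move=> d0 H; apply/eqP; rewrite eq_le d0 andbT leNgt; apply/negP => dp.
(* Chosen so that x^delta = |C| + 1 exceeds C. *)
pose x : R := (`|C| + 1) `^ delta^-1.
have x0 : 0 <= x by exact: powR_ge0.
have := H (Num.max T x); rewrite le_max lexx => /(_ isT); apply/negP; rewrite -ltNge.
apply: (@lt_le_trans _ _ (x `^ delta)).
  rewrite -powRrM mulVf ?gt_eqF// powRr1 ?addr_ge0//.
  by apply: le_lt_trans (ler_norm _) _; rewrite ltrDl.
by apply: ge0_ler_powR => //; rewrite ?nnegrE ?le_max ?x0 ?lexx ?orbT.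
Qed.

Theorem proposition1p6 (R : realType) (N m : nat) (m_gt0 : (1 <= m)%N)
  (Z : set 'rV[R]_N) (Z_open : open Z)
  (a : multi_index N -> 'rV[R]_N -> R[i])
  (a_smooth : forall b, (mi_deg b <= m)%N -> csmooth_on Z (a b))
  (phi : 'rV[R]_N -> R) (phi_smooth : smooth_on Z phi)
  (C tau1 : R) (C_gt0 : 0 < C) (tau1_gt0 : 0 < tau1)
  (alpha : multi_index N) (alpha_le : (mi_deg alpha <= m)%N)
  (delta : R) (delta_ge0 : 0 <= delta)
  (estimate : forall tau : R, tau1 <= tau ->
    forall u : 'rV[R]_N -> R[i], csmooth_on setT u -> csupp u `<=` Z ->
      ((tau `^ (m%:R - 1 - (mi_deg alpha)%:R + delta))%:E *
         L2norm (weighted tau phi (mi_D alpha u))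
       <= C%:E *
         L2norm (weighted tau phi (diffop m a u)))%E)
  (z0 : 'rV[R]_N) (z0_in : Z z0) (zeta0 : 'rV[R]_N)
  (tau0 : R) (tau0_gt0 : 0 < tau0)
  (theta0 : 'rV[R[i]]_N)
  (theta0E : theta0 = \row_j (zeta0 0 j +i* (tau0 * partial j phi z0)))
  (theta0_alpha : mi_pow theta0 alpha != 0)
  (char0 : principal_symbol m a z0 theta0 = 0)
  (dchar0 : diff_symbol (principal_symbol m a) z0 theta0 = 0) :
  delta = 0.
Proof.
have theta_Im j : complex.Im (theta0 0 j) = tau0 * partial j phi z0 by rewrite theta0E mxE.
have [r1 [K [r1_gt0 K_ge0 r1Z phi_taylor]]] := smooth_taylor Z_open z0_in phi_smooth.
(* [r < r1] is strict because the closed support of the packet must fit in the box of radius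
   [r1]. *)
have r_near : \forall r \near 0^'+, [/\ bigO (scaled_domain r) 2 (scaled_operator theta0 m a z0),
    r < r1 & 0 < r].
  near=> r; split; near: r; [|exact: nbhs_right_lt|exact: nbhs_right_gt].
  exact: (scaled_operator_bigO2 Z_open a_smooth z0_in char0 dchar0).
have [r [[L L_ge0 HL] r_lt r_gt0]] := @filter_ex _ _ (at_right_proper_filter (0 : R)) _ r_near.
have [K2 K2_ge0 HK2] := jet_bigO1 (@scaled_domain_eps R N r) (jet_packet_prod theta0 r alpha).
have [rho0 rho0_gt0 Hrho0] := bump0_lower R.
(* Capped at 1 to stay inside the unit box, where the expansions hold. *)
pose rho := Num.min rho0 1.
have rho_gt0 : 0 < rho by rewrite lt_min rho0_gt0 ltr01.
pose normc := @ComplexField.Normc.normc R.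
pose b0 := (bump 0 0 / 2 : R).
have b0_gt0 : 0 < b0 by rewrite divr_gt0// bump0_gt0.
(* Half of the lower bound for the leading term theta0^alpha chi on the box of radius [rho]; the
   other half absorbs the error K2 e. *)
pose c := normc (mi_pow theta0 alpha) * b0 ^+ N / 2.
have c_gt0 : 0 < c.
  rewrite divr_gt0// mulr_gt0 ?exprn_gt0// lt_def normc_ge0 andbT.
  by apply: contra_neq theta0_alpha => /ComplexField.Normc.eq0_normc.
have packet_lower e y : scaled_domain r e y -> box 0 rho y -> K2 * e <= c ->
    c <= normc (packet_prod theta0 alpha e y).
  move=> Dey yrho ec; have := HK2 _ _ Dey; rewrite expr1 => /le_trans/(_ ec) close.
  have lead : 2 * c <= normc (mi_pow theta0 alpha * bump_prod y).
    rewrite /c mulrC divfK// /normc ComplexField.Normc.normcM ler_wpM2l ?normc_ge0//.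
    rewrite /bump_prod (big_morph (@ComplexField.Normc.normc R)
      (@ComplexField.Normc.normcM R) (@ComplexField.Normc.normc1 R)).
    rewrite -[in b0 ^+ N](card_ord N) -prodr_const; apply: ler_prod => j _.
    apply/andP; split; first exact: ltW.
    rewrite normc_real; apply: le_trans (ler_norm _); apply: Hrho0.
    by have := yrho j; rewrite mxE subr0 /rho le_min => /andP[].
  set P := packet_prod _ _ _ _ in close *; set A := _ * bump_prod y in close lead.
  have : normc A <= normc (A - P) + normc P.
    by rewrite -{1}(subrK P A); exact: le_normcD.
  have -> : normc (A - P) = normc (P - A) by rewrite /normc -(normcN (P - A)) opprB.
  move=> tri; rewrite -/normc in close lead; lra.
(* The largest admissible e; dividing by K2 + 1 allows K2 = 0 and still gives K2 e <= c. *)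
pose eta := Num.min (Num.min 1 r) (c / (K2 + 1)).
have eta_gt0 : 0 < eta by rewrite !lt_min ltr01 r_gt0 divr_gt0// ltr_wpDl.
(* [A0] and [B0] are what is left of the two sides, A0 tau^delta <= B0, after cancellation; the
   powers of tau0 come from tau = tau0 s^2. *)
pose A0 := expR (- (tau0 * K)) * c * Num.sqrt (rho ^+ N) * (tau0 ^+ m.-1 / tau0 ^+ mi_deg alpha).
pose B0 := C * (expR (tau0 * K) * L).
have sq_gt0 : 0 < Num.sqrt (rho ^+ N) by rewrite sqrtr_gt0 exprn_gt0.
have A0_gt0 : 0 < A0.
  rewrite /A0; apply: mulr_gt0; last by rewrite divr_gt0 ?exprn_gt0.
  by apply: mulr_gt0 => //; rewrite mulr_gt0 ?expR_gt0.
(* Since e^2 = tau0 / tau, the threshold tau0 / eta^2 says exactly that e <= eta. *)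
apply: (@bounded_powR_eq0 R delta (B0 / A0) (Num.max tau1 (tau0 / eta ^+ 2))) => // tau.
rewrite ge_max => /andP[tau_ge tau_eta].
have tau_gt0 : 0 < tau by exact: lt_le_trans tau_ge.
pose s := Num.sqrt (tau / tau0).
have s_gt0 : 0 < s by rewrite sqrtr_gt0 divr_gt0.
have s_neq0 : s != 0 by rewrite gt_eqF.
have s2 : s ^+ 2 = tau / tau0 by rewrite sqr_sqrtr// ltW// divr_gt0.
have tauE : tau = tau0 * s ^+ 2 by rewrite s2; field; rewrite gt_eqF.
pose e := s^-1.
have e_gt0 : 0 < e by rewrite invr_gt0.
have e_eta : e <= eta.
  rewrite -ler_sqr ?nnegrE ?(ltW e_gt0) ?(ltW eta_gt0)// /e exprVn s2 invf_div.
  by rewrite ler_pdivrMr// mulrC -ler_pdivrMr ?exprn_gt0.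
have Ddom (y : 'rV[R]_N) : box 0 1 y -> scaled_domain r e y.
  by split=> //; rewrite e_gt0 /=; apply: le_trans e_eta _; rewrite ge_min lexx.
have e_r : e <= r by move: e_eta; rewrite !le_min => /andP[/andP[]].
have K2e : K2 * e <= c.
  have : e <= c / (K2 + 1) by move: e_eta; rewrite !le_min => /andP[].
  rewrite ler_pdivlMr ?ltr_wpDl// mulrDr mulr1 mulrC; apply: le_trans.
  by rewrite lerDl ltW.
have weight := @weight_phase R N theta0 z0 s s_gt0 phi tau0 K r1 tau0_gt0 theta_Im
  (le_trans e_r (ltW r_lt)) phi_taylor.
rewrite -tauE in weight.
have u_supp : csupp (wave_packet theta0 z0 s) `<=` Z.
  exact: (csupp_wave_packet s_gt0 r1Z (le_lt_trans e_r r_lt)).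
have := estimate tau tau_ge (wave_packet theta0 z0 s) (csmooth_wave_packet _ _ s_gt0) u_supp.
(* Pointwise bounds: [M1] from below for D^alpha u on the box of radius e rho, [M2] from above for Q
   u on the box of radius e, both with the weight. *)
pose M1 := expR (tau * phi z0 - tau0 * K) * (s ^+ (2 * mi_deg alpha) * c).
pose M2 := expR (tau * phi z0 + tau0 * K) * (s ^+ (2 * m) * (L * e ^+ 2)).
have sX_ge0 k : 0 <= s ^+ k by rewrite exprn_ge0// ltW.
have c_ge0 : 0 <= c by exact: ltW.
have M1_ge0 : 0 <= M1.
  by apply: mulr_ge0; [exact: expR_ge0|apply: mulr_ge0].
have M2_ge0 : 0 <= M2.
  apply: mulr_ge0; [exact: expR_ge0|apply: mulr_ge0 => //].
  by rewrite mulr_ge0// exprn_ge0// ltW.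
have erho_ge0 : 0 <= e * rho by rewrite mulr_ge0// ltW.
have normc_pow k : normc (s ^+ k)%:C = s ^+ k.
  by rewrite /normc normc_real ger0_norm// exprn_ge0// ltW.
have lower : ((M1 * Num.sqrt ((2 * (e * rho)) ^+ N))%:E <=
    L2norm (weighted tau phi (mi_D alpha (wave_packet theta0 z0 s))))%E.
  apply: (L2norm_ge (z0 := z0)) => // z zb.
  have yrho := iffLR (box_rescale z0 s_gt0 rho z) zb.
  have y1 : box 0 1 (s *: (z - z0)) by apply: le_box yrho; rewrite ge_min lexx orbT.
  have zb1 : box z0 s^-1 z.
    by apply: le_box zb; apply: ler_piMr; [exact: ltW|rewrite ge_min lexx orbT].
  have /andP[wz _] := weight _ zb1.
  rewrite normc_weighted mi_D_wave_packet// !ComplexField.Normc.normcM -/normc normc_pow.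
  have Pc := packet_lower _ _ (Ddom _ y1) yrho K2e.
  rewrite [leRHS](_ : _ = expR (tau * phi z) * normc (phase theta0 z0 s z) *
    (s ^+ (2 * mi_deg alpha) * normc (packet_prod theta0 alpha e (s *: (z - z0))))); last by ring.
  by apply: ler_pM; [exact: expR_ge0|exact: mulr_ge0|exact: wz|rewrite ler_wpM2l].
have upper : (L2norm (weighted tau phi (diffop m a (wave_packet theta0 z0 s))) <=
    (M2 * Num.sqrt ((2 * e) ^+ N))%:E)%E.
  apply: (L2norm_le (z0 := z0)) => //; first exact: ltW.
    move=> z zb; have zb1 : box z0 (s^-1 * 1) z by rewrite mulr1.
    have y1 := iffLR (box_rescale z0 s_gt0 1 z) zb1.
    have /andP[_ wz] := weight _ zb.
    rewrite normc_weighted diffop_wave_packet// !ComplexField.Normc.normcM -/normc normc_pow.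
    have Sc := HL _ _ (Ddom _ y1).
    rewrite [leLHS](_ : _ = expR (tau * phi z) * normc (phase theta0 z0 s z) *
      (s ^+ (2 * m) * normc (scaled_operator theta0 m a z0 e (s *: (z - z0))))); last by ring.
    apply: ler_pM; [|by rewrite mulr_ge0// normc_ge0|exact: wz|by rewrite ler_wpM2l].
    by rewrite mulr_ge0 ?expR_ge0 ?normc_ge0.
  move=> z zb; rewrite /weighted diffop_wave_packet// /scaled_operator big1 ?mulr0// => b _.
  rewrite packet_prod_out ?mulr0// => y1; apply: zb.
  by have := iffRL (box_rescale z0 s_gt0 1 z) y1; rewrite mulr1.
have p0 : 0 <= tau `^ (m%:R - 1 - (mi_deg alpha)%:R + delta) by exact: powR_ge0.
move=> est.
have : tau `^ (m%:R - 1 - (mi_deg alpha)%:R + delta) *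
    (M1 * Num.sqrt ((2 * (e * rho)) ^+ N)) <= C * (M2 * Num.sqrt ((2 * e) ^+ N)).
  rewrite -lee_fin !EFinM; apply: le_trans (le_trans est _).
    by rewrite -EFinM; apply: lee_wpmul2l; rewrite ?lee_fin.
  by rewrite -EFinM; apply: lee_wpmul2l; rewrite ?lee_fin// ltW.
set p := tau `^ (_ - _ - _ + _) in p0 est *.
(* The exponent m - 1 - |alpha| can be -1, hence a quotient of natural powers; [m.-1] is a true
   predecessor as m >= 1. *)
have {p0 est lower upper} pE : p * (s ^+ (2 * mi_deg alpha)) =
    tau0 ^+ m.-1 / tau0 ^+ mi_deg alpha * s ^+ (2 * m.-1) * tau `^ delta.
  have powE : p * tau ^+ mi_deg alpha = tau ^+ m.-1 * tau `^ delta.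
    rewrite -!powR_mulrn ?ltW// -!powRD ?(gt_eqF tau_gt0) ?implybT//.
    by congr (_ `^ _); rewrite -[in m%:R](prednK m_gt0) -natr1; ring.
  apply: (mulfI (x := tau0 ^+ mi_deg alpha)); first by rewrite expf_neq0// gt_eqF.
  rewrite mulrCA !exprM -exprMn -tauE powE {1}tauE exprMn; field.
  by rewrite expf_neq0// gt_eqF.
(* The gain e^2 on the right matches the power tau^(m-1) on the left, so only tau^delta remains
   unbalanced. *)
have sE : s ^+ (2 * m) * e ^+ 2 = s ^+ (2 * m.-1).
  rewrite -[in LHS](prednK m_gt0) mulnS exprD /e; field; exact: s_neq0.
set V := Num.sqrt ((2 * e) ^+ N).
have V_gt0 : 0 < V by rewrite sqrtr_gt0 exprn_gt0// mulr_gt0.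
(* The volumes of the two boxes differ by the factor rho^N, which does not depend on s. *)
have -> : Num.sqrt ((2 * (e * rho)) ^+ N) = V * Num.sqrt (rho ^+ N).
  by rewrite mulrA exprMn sqrtrM// exprn_ge0// ltW// mulr_gt0.
rewrite /M1 /M2 !expRD => ineq.
rewrite ler_pdivlMr//.
have XV_gt0 : 0 < expR (tau * phi z0) * V * s ^+ (2 * m.-1).
  by rewrite !mulr_gt0 ?expR_gt0 ?exprn_gt0.
rewrite -(ler_pM2r XV_gt0); apply: le_trans (le_trans ineq _); rewrite le_eqVlt; apply/orP; left; apply/eqP.
  rewrite [RHS](_ : _ = p * s ^+ (2 * mi_deg alpha) * (expR (tau * phi z0) *
    expR (- (tau0 * K)) * c * V * Num.sqrt (rho ^+ N))); last by ring.
  by rewrite pE /A0; ring.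
by rewrite mulrCA [L * _]mulrC mulrA -sE /B0; ring.
Unshelve. all: by end_near. Qed.
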